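(* For every constant $c>0$ there is a constant $C>0$ such that the following holds. Let $1/n\le\theta\le 1$ and $p\ge C n\log^4 n$, and let $X$ be an $n\times p$ Bernoulli–subgaussian random matrix with parameter $\theta$. Then $$\mathbb{P}\Big(\exists\, v\in\mathbb{R}^n:\ \big|\,\|X^T v\|_1-\mu_v\,\big|\ge c\,\mu_v\Big)=o(1)\quad\text{as } n\to\infty,$$ where $\mu_v:=\mathbb{E}\|X^Tv\|_1$.
   Context: An $n\times p$ Bernoulli–subgaussian random matrix with parameter $\theta\in(0,1]$ is a matrix $X=(x_{ij})$ with iid entries $x_{ij}=\chi_{ij}\xi_{ij}$, where the $\chi_{ij}$ are iid indicator random variables with $\mathbb{P}(\chi_{ij}=1)=\theta$, the $\xi_{ij}$ are iid random variables independent of the $\chi$'s, with mean $0$, variance at most $1$, $\mathbb{E}|\xi_{ij}|\in[1/10,1]$, and $\mathbb{P}(|\xi_{ij}|\ge t)\le 2\exp(-t^2/2)$ for all $t>0$. $\|\cdot\|_1$ is the $\ell_1$ norm.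
   Formalization: The vector v is required to be nonzero: for v = 0 both ‖X^T v‖₁ and μ_v are 0, so the inequality |0 − 0| ≥ c·0 always holds and the event as literally written would have probability 1. *)

(* Defs.v *)
From mathcomp Require Import all_boot all_order all_algebra.
From mathcomp Require Import all_classical all_reals all_analysis.
Set Implicit Arguments. Unset Strict Implicit. Unset Printing Implicit Defensive.
Import Order.TTheory GRing.Theory Num.Theory.
Local Open Scope classical_set_scope.
Local Open Scope ring_scope.

Section Defs.
Context {d : measure_display} {T : measurableType d} {R : realType}.

Definition mutually_independent (I : finType) (P : probability T R)
  (X : I -> T -> R) : Prop :=
  (forall i, measurable_fun setT (X i)) /\
  forall (J : {set I}) (B : I -> set R), (forall i, measurable (B i)) ->
    P (\bigcap_(i in [set i | i \in J]) (X i @^-1` B i)) =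
    (\prod_(i in J) P (X i @^-1` B i))%E.

(* chi, xi : the n x p arrays of random variables; X_ij = chi_ij * xi_ij *)
Definition bs_family (n p : nat) (chi xi : 'I_n -> 'I_p -> T -> R) :
  ('I_n * 'I_p) + ('I_n * 'I_p) -> T -> R :=
  fun k => match k with inl ij => chi ij.1 ij.2 | inr ij => xi ij.1 ij.2 end.

Definition bernoulli_subgaussian (n p : nat) (P : probability T R) (theta : R)
  (chi xi : 'I_n -> 'I_p -> T -> R) : Prop :=
  [/\ mutually_independent P (bs_family chi xi),
      (forall i j w, chi i j w = 0 \/ chi i j w = 1),
      (forall i j, P (chi i j @^-1` [set 1]) = theta%:E),
      (forall i j i' j' (B : set R), measurable B ->
          P (xi i j @^-1` B) = P (xi i' j' @^-1` B)) &
      (forall i j,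
        [/\ P.-integrable setT (EFin \o xi i j),
            (\int[P]_w (xi i j w)%:E = 0)%E,
            (\int[P]_w ((xi i j w) ^+ 2)%:E <= 1)%E,
            ((1 / 10)%:E <= \int[P]_w (`|xi i j w|)%:E <= 1)%E &
            (forall t : R, 0 < t ->
               (P [set w | (t <= `|xi i j w|)%R ] <= (2 * expR (- (t ^+ 2) / 2))%:E)%E)])].

Definition rmat (n p : nat) (chi xi : 'I_n -> 'I_p -> T -> R) (w : T) : 'M[R]_(n, p) :=
  \matrix_(i, j) (chi i j w * xi i j w).

Definition l1norm (m : nat) (u : 'cV[R]_m) : R := \sum_(k < m) `|u k 0|.

Definition mu_v (n p : nat) (P : probability T R) (chi xi : 'I_n -> 'I_p -> T -> R)
  (v : 'cV[R]_n) : \bar R :=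
  (\int[P]_w (l1norm ((rmat chi xi w)^T *m v))%:E)%E.

Definition bad_event (n p : nat) (P : probability T R) (chi xi : 'I_n -> 'I_p -> T -> R)
  (c : R) : set T :=
  [set w | exists v : 'cV[R]_n, v != 0 /\
     (c%:E * mu_v P chi xi v <= `| (l1norm ((rmat chi xi w)^T *m v))%:E - mu_v P chi xi v |)%E].

Definition outer_prob_le (P : probability T R) (E : set T) (eps : R) : Prop :=
  exists A, measurable A /\ E `<=` A /\ (P A <= eps%:E)%E.

End Defs.

(* Main.v *)
Require Import Defs.
From mathcomp Require Import all_boot all_order all_algebra.
From mathcomp Require Import all_classical all_reals all_analysis.
From mathcomp Require Import measurable_realfun ring lra.
Set Implicit Arguments. Unset Strict Implicit. Unset Printing Implicit Defensive.
Import Order.TTheory GRing.Theory Num.Theory.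
Local Open Scope classical_set_scope.
Local Open Scope ring_scope.

(** Write x_1, ..., x_p for the columns of X. The xi_ij are rounded to finitely
    many values and recentred, at a cost that is negligible once n and p are
    fixed, so that everything happens in a finite product space.

    Lower bound on mu_v. Pairing <x, v> with phi = sum_i sgn(v_i) chi_i
    (sgn(xi_i) - E sgn(xi_i)), whose values beyond a level of order
    sqrt(theta n) ln n contribute negligibly, gives
    E |<x, v>| >= c sqrt(theta / n) |v|_1 / ln n.

    Upper bound on the deviation. Replacing the columns by signed columns one
    at a time (symmetrisation and contraction in a single step) bounds
    E sup_{|v|_1 <= 1} | |X^T v|_1 - mu_v | by a multiple of
    E max_i |sum_j eps_j x_ij| = O(sqrt(theta p ln n)).

    By Markov's inequality the bad event has probability
    O(sqrt(n / p) (ln n)^{3/2}), hence O((ln n)^{-1/2}), already for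
    p >= n (ln n)^4. *)

(** * Expectations on finite product spaces, symmetrisation *)

Section FiniteProduct.
Context {R : realType}.

(** No net over v is used: both bounds are proportional to |v|_1, and a linear form on the l1 ball
    is at most its largest coefficient in absolute value, so only the n row sums have to be
    controlled, at the price of a factor sqrt(ln n). The obstacle is the lower bound: |v|_1 may be
    far larger than the Euclidean norm of v, and the xi_ij need not be symmetric. For the rounded
    entries the pairing with phi has expectation theta E|xi| |v|_1, the cross terms vanishing
    because each entry has mean zero. Centring the sign keeps phi on the scale sqrt(theta n), where
    its mean could otherwise be of order theta n; since E xi = 0, the centring costs no correlation.
    Finiteness serves independence: the product formula for events becomes a product of weights,
    conditioning becomes summation over one coordinate, and a worst v can be chosen for each
    outcome, so that the supremum is a finite maximum. *)

Definition prob_weight (S : finType) (w : S -> R) :=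
  (forall e, 0 <= w e) /\ \sum_e w e = 1.

Definition Ex (I S : finType) (W : I -> S -> R) (G : {ffun I -> S} -> R) : R :=
  \sum_(s : {ffun I -> S}) (\prod_i W i (s i)) * G s.

Section Ex_theory.
Variables (I S : finType) (W : I -> S -> R).
Hypothesis hW : forall i, prob_weight (W i).

Lemma Ex_prod (g : I -> S -> R) :
  Ex W (fun s => \prod_i g i (s i)) = \prod_i \sum_e W i e * g i e.
Proof.
rewrite bigA_distr_bigA /Ex; apply: eq_bigr => s _.
by rewrite big_split.
Qed.

Lemma eq_Ex G H : G =1 H -> Ex W G = Ex W H.
Proof. by move=> GH; apply: eq_bigr => s _; rewrite GH. Qed.

Lemma Ex_le G H : (forall s, G s <= H s) -> Ex W G <= Ex W H.
Proof.
move=> GH; apply: ler_sum => s _; apply: ler_wpM2l (GH s).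
by apply: prodr_ge0 => i _; apply: (hW i).1.
Qed.

Lemma ExD G H : Ex W (fun s => G s + H s) = Ex W G + Ex W H.
Proof. by rewrite -big_split; apply: eq_bigr => s _; rewrite mulrDr. Qed.

Lemma ExZ a G : Ex W (fun s => a * G s) = a * Ex W G.
Proof. by rewrite mulr_sumr; apply: eq_bigr => s _; rewrite mulrCA. Qed.

Lemma Ex_sum (J : finType) (G : J -> {ffun I -> S} -> R) :
  Ex W (fun s => \sum_j G j s) = \sum_j Ex W (G j).
Proof.
by rewrite exchange_big; apply: eq_bigr => s _; rewrite mulr_sumr.
Qed.

Lemma Ex1 : Ex W (fun=> 1) = 1.
Proof.
transitivity (Ex W (fun s => \prod_i (fun (_ : I) (_ : S) => 1) i (s i))).
  by apply: eq_Ex => s; rewrite big1.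
rewrite (Ex_prod (fun _ _ => 1)) big1 // => i _.
by under eq_bigr do rewrite mulr1; exact: (hW i).2.
Qed.

Lemma Ex_cst a : Ex W (fun=> a) = a.
Proof. by rewrite -[RHS]mulr1 -Ex1 -ExZ; apply: eq_Ex => s; rewrite mulr1. Qed.

(** Independence with one distinguished coordinate: below, coordinate k carries a factor [|x k|]
    besides its exponential, while the others carry an exponential only. *)
Lemma Ex_factor k (g : S -> R) (h : I -> S -> R) :
  Ex W (fun s => g (s k) * \prod_(i | i != k) h i (s i)) =
  (\sum_e W k e * g e) * \prod_(i | i != k) \sum_e W i e * h i e.
Proof.
pose f i e := if i == k then g e else h i e.
transitivity (Ex W (fun s => \prod_i f i (s i))).
  apply: eq_Ex => s; rewrite [RHS](bigD1 k) //= /f eqxx; congr (_ * _).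
  by apply: eq_bigr => i /negPf->.
rewrite (Ex_prod f) (bigD1 k) //= /f eqxx; congr (_ * _).
by apply: eq_bigr => i /negPf->.
Qed.

Lemma Ex_single k (g : S -> R) : Ex W (fun s => g (s k)) = \sum_e W k e * g e.
Proof.
transitivity (Ex W (fun s => g (s k) * \prod_(i | i != k) (fun (_ : I) (_ : S) => 1) i (s i))).
  by apply: eq_Ex => s; rewrite big1 // mulr1.
rewrite (Ex_factor k g (fun _ _ => 1)) [X in _ * X]big1 ?mulr1 // => i _.
by under eq_bigr do rewrite mulr1; exact: (hW i).2.
Qed.

Lemma Ex_pair k l (g h : S -> R) : l != k ->
  Ex W (fun s => g (s k) * h (s l)) =
  (\sum_e W k e * g e) * (\sum_e W l e * h e).
Proof.
move=> lk; pose f i e := if i == l then h e else 1.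
transitivity (Ex W (fun s => g (s k) * \prod_(i | i != k) f i (s i))).
  apply: eq_Ex => s; rewrite (bigD1 l) //= /f eqxx big1 ?mulr1 //.
  by move=> i /andP[_ /negPf->].
rewrite (Ex_factor k g f); congr (_ * _).
rewrite (bigD1 l) //= /f eqxx [X in _ * X]big1 ?mulr1 // => i /andP[_ /negPf->].
by under eq_bigr do rewrite mulr1; exact: (hW i).2.
Qed.

Lemma prob_weight_prod :
  prob_weight (fun s : {ffun I -> S} => \prod_i W i (s i)).
Proof.
split=> [s|]; first by apply: prodr_ge0 => i _; apply: (hW i).1.
by rewrite -[RHS]Ex1; apply: eq_bigr => s _; rewrite mulr1.
Qed.

End Ex_theory.

Definition fcons (S : finType) k (e : S) (s : {ffun 'I_k -> S}) :
  {ffun 'I_k.+1 -> S} := [ffun i => oapp s e (unlift ord0 i)].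

Lemma fcons0 (S : finType) k (e : S) (s : {ffun 'I_k -> S}) :
  fcons e s ord0 = e.
Proof. by rewrite ffunE unlift_none. Qed.

Lemma fconsS (S : finType) k (e : S) (s : {ffun 'I_k -> S}) i :
  fcons e s (lift ord0 i) = s i.
Proof. by rewrite ffunE liftK. Qed.

Lemma Ex_recl (S : finType) k (W : 'I_k.+1 -> S -> R) G :
  Ex W G = \sum_e W ord0 e *
     Ex (fun i => W (lift ord0 i)) (fun s => G (fcons e s)).
Proof.
rewrite /Ex; under [RHS]eq_bigr do rewrite mulr_sumr.
rewrite pair_big (reindex (fun q : S * {ffun 'I_k -> S} => fcons q.1 q.2)) /=.
  apply: eq_bigr => -[e s] _ /=.
  rewrite big_ord_recl fcons0 -mulrA; congr (_ * (_ * _)).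
  by apply: eq_bigr => i _; rewrite fconsS.
exists (fun s => (s ord0, [ffun i => s (lift ord0 i)])) => [[e s]|s] _ /=.
  by rewrite fcons0; congr (_, _); apply/ffunP => i; rewrite ffunE fconsS.
apply/ffunP => i; rewrite ffunE; case: unliftP => [j|] -> //=.
by rewrite ffunE.
Qed.

Lemma Ex_ord0 (S : finType) (W : 'I_0 -> S -> R) G (s0 : {ffun 'I_0 -> S}) :
  Ex W G = G s0.
Proof.
rewrite /Ex (bigD1 s0) //= big_ord0 mul1r big1 ?addr0 // => s /negP[].
by apply/eqP/ffunP => -[].
Qed.

(** * Symmetrisation and contraction over a finite index set *)

Section Symmetrisation.
Variables (J : finType) (i0 : J).

(** The default [A i0] is itself one of the values, so this is the true maximum even if all values
    are negative. *)
Definition fmax (A : J -> R) : R := \big[Num.max/A i0]_i A i.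

Lemma fmax_ge A i : A i <= fmax A.
Proof. exact: le_bigmax. Qed.

Lemma fmax_le A x : (forall i, A i <= x) -> fmax A <= x.
Proof. by move=> h; apply: bigmax_le. Qed.

Lemma eq_fmax A B : A =1 B -> fmax A = fmax B.
Proof. by move=> AB; rewrite /fmax AB; apply: eq_bigr => i _. Qed.

Definition sg (b : bool) : R := if b then 1 else -1.

Variable psi : R -> R.
Hypothesis psi_lip : forall x y, psi x - psi y <= `|x - y|.

Lemma fmaxD_le A B x : (forall i j, A i + B j <= x) -> fmax A + fmax B <= x.
Proof.
move=> h; rewrite -lerBrDr; apply: fmax_le => i.
by rewrite lerBrDr addrC -lerBrDr; apply: fmax_le => j; rewrite lerBrDr addrC.
Qed.

(** Fix indices i and j for the two maxima on the left. The Lipschitz bound replaces the difference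
    of the psi values by |t i - t j|; if this is t j - t i, the two indices exchange their roles on
    the right. *)
Lemma contraction (A t : J -> R) :
  fmax (fun v => A v + 2 * psi (t v)) + fmax (fun v => A v - 2 * psi (t v)) <=
  fmax (fun v => A v + 2 * t v) + fmax (fun v => A v - 2 * t v).
Proof.
apply: fmaxD_le => i j; have := psi_lip (t i) (t j).
have := fmax_ge (fun v => A v + 2 * t v) i.
have := fmax_ge (fun v => A v + 2 * t v) j.
have := fmax_ge (fun v => A v - 2 * t v) i.
have := fmax_ge (fun v => A v - 2 * t v) j.
case: (leP 0 (t i - t j)) => h; rewrite ?(ger0_norm h) ?(ltr0_norm h); lra.
Qed.

(** By Jensen the mean is replaced by an independent copy e'. The term is then the average of A + 2
    psi(t e) and A - 2 psi(t e'), so the bound separates into a function of e and one of e'. As both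
    have law w, the copy can be identified with e itself, and contraction applies for each e. The
    factor 2 pays for this separation. *)
Lemma symmetrise_one (S : finType) (w : S -> R) (t : S -> J -> R) (A : J -> R) :
  prob_weight w ->
  \sum_e w e * fmax (fun v => A v + (psi (t e v) - \sum_e' w e' * psi (t e' v)))
  <= \sum_(e : S * bool) (w e.1 / 2) *
       fmax (fun v => A v + 2 * (sg e.2 * t e.1 v)).
Proof.
move=> [w0 w1].
pose P e := fmax (fun v => A v + 2 * psi (t e v)).
pose Q e := fmax (fun v => A v - 2 * psi (t e v)).
apply: (@le_trans _ _ (\sum_e w e * ((P e + \sum_e' w e' * Q e') / 2))).
  apply: ler_sum => e _; apply: ler_wpM2l => //; apply: fmax_le => v.
  have -> : A v + (psi (t e v) - \sum_e' w e' * psi (t e' v)) =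
    (A v + 2 * psi (t e v) + \sum_e' w e' * (A v - 2 * psi (t e' v))) / 2.
    have -> : \sum_e' w e' * (A v - 2 * psi (t e' v)) =
        A v - 2 * \sum_e' w e' * psi (t e' v).
      rewrite -[X in X - _]mul1r -w1 mulr_suml mulr_sumr -sumrB.
      by apply: eq_bigr => e' _; ring.
    by field.
  rewrite ler_pM2r ?invr_gt0 //; apply: lerD.
    exact: (fmax_ge (fun v => A v + 2 * psi (t e v))).
  apply: ler_sum => e' _; apply: ler_wpM2l => //.
  exact: (fmax_ge (fun v => A v - 2 * psi (t e' v))).
apply: (@le_trans _ _ (\sum_e w e * ((P e + Q e) / 2))).
  rewrite le_eqVlt; apply/orP; left; apply/eqP.
  transitivity ((\sum_e w e * P e + (\sum_e w e) * \sum_e w e * Q e) / 2).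
    by rewrite mulr_suml -big_split mulr_suml; apply: eq_bigr => e _ /=; field.
  by rewrite w1 mul1r -big_split mulr_suml; apply: eq_bigr => e _ /=; field.
rewrite -(pair_bigA _ (fun e b => w e / 2 * fmax (fun v => A v + 2 * (sg b * t e v)))) /=.
apply: ler_sum => e _; rewrite big_bool /= -mulrDr -mulrA ler_wpM2l //.
rewrite mulrC ler_wpM2l ?invr_ge0 //.
apply: le_trans (contraction A (t e)) _; rewrite le_eqVlt; apply/orP; left.
by apply/eqP; congr (_ + _); apply: eq_fmax => v /=; ring.
Qed.

(** The offset A is arbitrary so that the induction closes: with the other columns fixed they join
    the offset while the first one is symmetrised, after which the signed first column joins the
    offset of the induction hypothesis. *)
Lemma symmetrisation (S : finType) k (W : 'I_k -> S -> R)
    (t : 'I_k -> S -> J -> R) (A : J -> R) :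
  (forall j, prob_weight (W j)) ->
  Ex W (fun s => fmax (fun v => A v +
     \sum_j (psi (t j (s j) v) - \sum_e W j e * psi (t j e v)))) <=
  Ex (fun j (e : S * bool) => W j e.1 / 2) (fun s => fmax (fun v => A v +
     \sum_j 2 * (sg (s j).2 * t j (s j).1 v))).
Proof.
elim: k W t A => [|k IH] W t A hW.
  rewrite (Ex_ord0 _ _ (finfun (fun i : 'I_0 => match i with Ordinal m lt => False_rect _ (notF lt) end))).
  rewrite (Ex_ord0 _ _ (finfun (fun i : 'I_0 => match i with Ordinal m lt => False_rect _ (notF lt) end))).
  by under eq_fmax do rewrite big_ord0; under [leRHS]eq_fmax do rewrite big_ord0.
rewrite !Ex_recl /=.
under eq_bigr do rewrite -ExZ.
rewrite -Ex_sum.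
pose B (s : {ffun 'I_k -> S}) v := A v + \sum_(j < k) (psi (t (lift ord0 j) (s j) v) -
   \sum_e W (lift ord0 j) e * psi (t (lift ord0 j) e v)).
apply: (@le_trans _ _ (Ex (fun j => W (lift ord0 j)) (fun s =>
   \sum_(e : S * bool) (W ord0 e.1 / 2) *
       fmax (fun v => B s v + 2 * (sg e.2 * t ord0 e.1 v))))).
  apply: Ex_le => // s.
  apply: le_trans (symmetrise_one (t ord0) (B s) (hW ord0)).
  apply: ler_sum => e _; apply: ler_wpM2l; first exact: (hW ord0).1.
  rewrite le_eqVlt; apply/orP; left; apply/eqP/eq_fmax => v.
  rewrite /B big_ord_recl fcons0 [RHS]addrAC [LHS]addrA; congr (_ + _).
  by apply: eq_bigr => j _; rewrite fconsS.
rewrite Ex_sum; apply: ler_sum => -[e b] _ /=; rewrite ExZ.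
apply: ler_wpM2l; first by rewrite divr_ge0 // (hW ord0).1.
apply: (@le_trans _ _ (Ex (fun j => W (lift ord0 j)) (fun s => fmax (fun v =>
   (A v + 2 * (sg b * t ord0 e v)) + \sum_(j < k) (psi (t (lift ord0 j) (s j) v) -
   \sum_e W (lift ord0 j) e * psi (t (lift ord0 j) e v)))))).
  by rewrite le_eqVlt; apply/orP; left; apply/eqP/eq_Ex => s; apply: eq_fmax => v; rewrite /B addrAC.
apply: le_trans (IH _ (fun j => t (lift ord0 j)) _ _) _ => //.
rewrite le_eqVlt; apply/orP; left; apply/eqP/eq_Ex => s; apply: eq_fmax => v.
rewrite big_ord_recl fcons0 addrA; congr (_ + _).
by apply: eq_bigr => j _; rewrite fconsS.
Qed.

End Symmetrisation.
End FiniteProduct.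

(** * Lower bound for the expected norm *)

Section EntryLaw.
Context {R : realType}.

(** Here x is the matrix entry and u its companion in the test variable phi, carried by one law w
    because they are correlated. Every moment bound keeps the factor [th]; this produces the scales
    sqrt(theta n) and sqrt(theta p). *)
Definition entry_law (E : finType) (th C1 ka : R) (w x u : E -> R) : Prop :=
  [/\ prob_weight w, \sum_e w e * x e = 0, \sum_e w e * `|x e| <= 2 * th,
      forall m, `|m| <= 1 ->
        \sum_e w e * (expR (m * x e) + expR (- (m * x e))) <=
        2 * (1 + C1 * th * m ^+ 2) &
  [/\ forall e, `|u e| <= 2,
      forall m, `|m| <= 1 / 4 ->
        \sum_e w e * expR (m * u e) <= 1 + 8 * th * m ^+ 2 &
      ka * th <= \sum_e w e * (x e * u e)]].

Lemma norm_sg_le1 (a : R) : `|Num.sg a| <= 1.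
Proof. by rewrite normr_sg; case: (a != 0). Qed.

Lemma expR_norm_le (y : R) : expR `|y| <= expR y + expR (- y).
Proof.
case: (leP 0 y) => h; rewrite ?(ger0_norm h) ?(ltr0_norm h).
  by rewrite lerDl expR_ge0.
by rewrite lerDr expR_ge0.
Qed.

(** A smooth truncation at level L: the excess satisfies l (|y| - L) <= exp(l (|y| - L)). It serves
    both for the large values of phi and for the maximum of the row sums. *)
Lemma le_exp_excess (l L y : R) : 0 < l ->
  `|y| <= L + expR (- (l * L)) / l * (expR (l * y) + expR (- (l * y))).
Proof.
move=> l0; rewrite -lerBlDl -(ler_pM2l l0).
have -> : l * (expR (- (l * L)) / l * (expR (l * y) + expR (- (l * y)))) =
  expR (- (l * L)) * (expR (l * y) + expR (- (l * y))).
  by field; rewrite gt_eqF.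
have h1 : l * (`|y| - L) <= expR (l * (`|y| - L)).
  by apply: le_trans (expR_ge1Dx _); rewrite lerDr.
apply: (le_trans h1); rewrite mulrBr addrC expRD ler_pM2l ?expR_gt0 //.
by have := expR_norm_le (l * y); rewrite normrM (gtr0_norm l0).
Qed.

(* Testing against phi = sum_i sg(v_i) u_i, truncated at level L. *)
Lemma l1norm_le_Ex (I E : finType) (w x u : I -> E -> R) (th C1 ka l L : R)
    (v : I -> R) :
  0 <= th -> (forall i, entry_law th C1 ka (w i) (x i) (u i)) ->
  0 < l -> l <= 1 / 4 -> 0 <= L ->
  ka * th * \sum_i `|v i| <=
  L * Ex w (fun s => `|\sum_i v i * x i (s i)|) +
  (\sum_i `|v i|) * (4 * th * expR 1 * expR (8 * th * l ^+ 2 * #|I|%:R) *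
     (expR (- (l * L)) / l)).
Proof.
move=> th0 hw l0 l4 L0.
have hp i : prob_weight (w i) by case: (hw i).
pose phi (s : {ffun I -> E}) := \sum_i Num.sg (v i) * u i (s i).
pose z (s : {ffun I -> E}) := \sum_i v i * x i (s i).
have low : ka * th * \sum_i `|v i| <= Ex w (fun s => z s * phi s).
  have -> : Ex w (fun s => z s * phi s) =
      \sum_k v k * Num.sg (v k) * \sum_e w k e * (x k e * u k e).
    transitivity (Ex w (fun s => \sum_k \sum_i v k * Num.sg (v i) *
        (x k (s k) * u i (s i)))).
      apply: eq_Ex => s; rewrite /z /phi mulr_suml; apply: eq_bigr => k _.
      by rewrite mulr_sumr; apply: eq_bigr => i _; ring.
    rewrite Ex_sum; apply: eq_bigr => k _; rewrite Ex_sum (bigD1 k) //=.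
    rewrite ExZ (Ex_single hp k (fun e => x k e * u k e)).
    rewrite [X in _ + X]big1 ?addr0 // => i ik.
    by rewrite ExZ (Ex_pair hp _ _ ik); case: (hw k) => _ -> _ _ _; rewrite mul0r mulr0.
  rewrite mulr_sumr; apply: ler_sum => k _.
  rewrite [v k * _]mulrC -normrEsg mulrC ler_wpM2l //.
  by case: (hw k) => _ _ _ _ [].
(* In coordinate k the exponent is at most 2 l <= 1, which gives the factor [expR 1], and E|x_k| <=
   2 th. Every other coordinate contributes at most exp(8 th l^2). *)
have mgf k m : `|m| <= l -> Ex w (fun s => `|x k (s k)| * expR (m * phi s)) <=
   2 * th * expR 1 * expR (8 * th * l ^+ 2 * #|I|%:R).
  move=> ml.
  have msg i : `|m * Num.sg (v i)| <= l.
    rewrite normrM (le_trans _ ml) // -[leRHS]mulr1 ler_wpM2l //.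
    exact: norm_sg_le1.
  have -> : Ex w (fun s => `|x k (s k)| * expR (m * phi s)) =
      (\sum_e w k e * (`|x k e| * expR (m * Num.sg (v k) * u k e))) *
      \prod_(i | i != k) \sum_e w i e * expR (m * Num.sg (v i) * u i e).
    rewrite -(Ex_factor _ k (fun e => `|x k e| * expR (m * Num.sg (v k) * u k e))
      (fun i e => expR (m * Num.sg (v i) * u i e))).
    apply: eq_Ex => s; rewrite /phi mulr_sumr expR_sum (bigD1 k) //=.
    rewrite !mulrA; congr (_ * _).
    by apply: eq_bigr => i _; rewrite mulrA.
  apply: ler_pM.
  - by apply: sumr_ge0 => e _; rewrite mulr_ge0 ?(hp k).1 // mulr_ge0 ?expR_ge0.
  - apply: prodr_ge0 => i _; apply: sumr_ge0 => e _.
    by rewrite mulr_ge0 ?(hp i).1 ?expR_ge0.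
  - case: (hw k) => _ _ hx _ [hu _ _].
    apply: le_trans (ler_wpM2r (expR_ge0 1) hx).
    rewrite mulr_suml; apply: ler_sum => e _; rewrite -[leRHS]mulrA.
    rewrite ler_wpM2l ?(hp k).1 // ler_wpM2l // ler_expR.
    rewrite (le_trans (ler_norm _)) // normrM.
    apply: le_trans (ler_pM _ _ (msg k) (hu e)) _ => //; lra.
  - set q := 8 * th * l ^+ 2.
    have q0 : 0 <= q by rewrite /q mulr_ge0 ?sqr_ge0 // mulr_ge0.
    apply: (@le_trans _ _ (\prod_(i | i != k) expR q)).
      apply: ler_prod => i _; apply/andP; split.
        by apply: sumr_ge0 => e _; rewrite mulr_ge0 ?(hp i).1 ?expR_ge0.
      case: (hw i) => _ _ _ _ [_ hu _].
      apply: le_trans (hu _ _) _; first exact: le_trans (msg i) l4.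
      apply: le_trans (expR_ge1Dx _); rewrite lerD2l /q.
      rewrite ler_wpM2l ?mulr_ge0 // -[X in X <= _]real_normK ?num_real //.
      by rewrite lerXn2r ?nnegrE // ltW.
    rewrite -expR_sum ler_expR sumr_const -[q *+ _]mulr_natr.
    by rewrite ler_wpM2l // ler_nat max_card.
(* In the excess term |z| is expanded by the triangle inequality, so that each summand contains a
   single |x_k| and falls under [mgf]. *)
have pw s : z s * phi s <= L * `|z s| + (expR (- (l * L)) / l) *
   \sum_k `|v k| * (`|x k (s k)| * expR (l * phi s) + `|x k (s k)| * expR (- l * phi s)).
  apply: le_trans (ler_norm _) _; rewrite normrM.
  apply: le_trans (ler_wpM2l (normr_ge0 _) (le_exp_excess L (phi s) l0)) _.
  rewrite [leLHS]mulrDr [`|z s| * L]mulrC lerD2l mulrCA ler_wpM2l //.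
    by rewrite divr_ge0 ?expR_ge0 // ltW.
  rewrite -mulNr.
  have -> : \sum_k `|v k| * (`|x k (s k)| * expR (l * phi s) + `|x k (s k)| * expR (- l * phi s)) =
     (\sum_k `|v k * x k (s k)|) * (expR (l * phi s) + expR (- l * phi s)).
    by rewrite mulr_suml; apply: eq_bigr => k _; rewrite normrM; ring.
  by rewrite ler_wpM2r ?addr_ge0 ?expR_ge0 // ler_norm_sum.
apply: le_trans low _; apply: le_trans (Ex_le hp pw) _.
rewrite ExD !ExZ lerD2l Ex_sum [leLHS]mulrC [leRHS]mulrA.
rewrite ler_wpM2r ?divr_ge0 ?expR_ge0 ?(ltW l0) //.
rewrite [leRHS]mulr_suml; apply: ler_sum => k _; rewrite ExZ ler_wpM2l // ExD.
have := mgf k l; rewrite (gtr0_norm l0) lexx => /(_ isT) h1.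
have := mgf k (- l); rewrite normrN (gtr0_norm l0) lexx => /(_ isT) h2.
by apply: le_trans (lerD h1 h2) _; rewrite le_eqVlt; apply/orP; left; apply/eqP; ring.
Qed.
End EntryLaw.

(** * Deviations of finitely supported columns *)

Section FiniteDeviation.
Context {R : realType}.
Variables (n p : nat) (E : finType) (w x u : 'I_n -> 'I_p -> E -> R).
Variables (th C1 ka : R).
Hypothesis hw : forall i j, entry_law th C1 ka (w i j) (x i j) (u i j).

Definition colw (j : 'I_p) (s : {ffun 'I_n -> E}) : R := \prod_i w i j (s i).

Definition colval (j : 'I_p) (s : {ffun 'I_n -> E}) (v : 'I_n -> R) : R :=
  \sum_i v i * x i j (s i).

Let hp i j : prob_weight (w i j). Proof. by case: (hw i j). Qed.

Lemma prob_weight_colw j : prob_weight (colw j).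
Proof. exact: (prob_weight_prod (fun i => hp i j)). Qed.

Let signedw (j : 'I_p) (e : {ffun 'I_n -> E} * bool) : R := colw j e.1 / 2.

Lemma prob_weight_signed j : prob_weight (signedw j).
Proof.
split=> [e|]; first by rewrite divr_ge0 // (prob_weight_colw j).1.
rewrite -(pair_bigA _ (fun e (b : bool) => colw j e / 2)) /=.
under eq_bigr do rewrite big_bool /= -splitr.
exact: (prob_weight_colw j).2.
Qed.

Let rowsum i (s : {ffun 'I_p -> {ffun 'I_n -> E} * bool}) : R :=
  \sum_j sg (s j).2 * x i j ((s j).1 i).

(** Averaging over the fair sign turns each factor into half the symmetrised exponential moment of
    [entry_law]. *)
Lemma Ex_expR_rowsum i (m : R) : `|m| <= 1 ->
  Ex signedw (fun s => expR (m * rowsum i s)) <= expR (C1 * th * m ^+ 2 * p%:R).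
Proof.
move=> m1.
have -> : Ex signedw (fun s => expR (m * rowsum i s)) =
    \prod_j \sum_e signedw j e * expR (m * (sg e.2 * x i j (e.1 i))).
  rewrite -(Ex_prod _ (fun j (e : {ffun 'I_n -> E} * bool) => expR (m * (sg e.2 * x i j (e.1 i))))).
  by apply: eq_Ex => s; rewrite /rowsum mulr_sumr expR_sum.
apply: (@le_trans _ _ (\prod_(j < p) expR (C1 * th * m ^+ 2))); last first.
  by rewrite -expR_sum ler_expR sumr_const card_ord -[_ *+ p]mulr_natr.
apply: ler_prod => j _; apply/andP; split.
  by apply: sumr_ge0 => e _; rewrite mulr_ge0 ?(prob_weight_signed j).1 ?expR_ge0.
rewrite -(pair_bigA _ (fun e b => colw j e / 2 * expR (m * (sg b * x i j (e i))))) /=.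
under eq_bigr do rewrite big_bool /= mul1r mulN1r mulrN -mulrDr -mulrA.
pose g a := 2^-1 * (expR (m * x i j a) + expR (- (m * x i j a))).
rewrite (_ : \sum_e _ = Ex (fun i => w i j) (fun s => g (s i))); last by [].
rewrite (Ex_single (fun i => hp i j)) /g.
under eq_bigr do rewrite mulrCA.
rewrite -mulr_sumr; apply: le_trans (expR_ge1Dx _).
by case: (hw i j) => _ _ _ /(_ m m1) h _; lra.
Qed.

(** On the l1 ball the linear form is at most twice the largest |row sum|, and [le_exp_excess]
    bounds that maximum by a sum over the n rows. Hence the size of J does not enter. The exponent
    used is 2 l, whence l <= 1/2. *)
Lemma Ex_fmax_rowsum (J : finType) (i0 : J) (v : J -> 'I_n -> R) (l L : R) :
  (forall k, \sum_i `|v k i| <= 1) -> 0 < l -> l <= 1 / 2 -> 0 <= L ->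
  Ex signedw (fun s => fmax i0 (fun k => 0 +
     \sum_j 2 * (sg (s j).2 * colval j (s j).1 (v k)))) <=
  L + expR (- (l * L)) / l * (2 * n%:R * expR (4 * C1 * th * l ^+ 2 * p%:R)).
Proof.
move=> v1 l0 l2 L0.
pose c := expR (- (l * L)) / l.
have c0 : 0 <= c by rewrite divr_ge0 ?expR_ge0 // ltW.
have pw (s : {ffun 'I_p -> {ffun 'I_n -> E} * bool}) : fmax i0 (fun k => 0 + \sum_j 2 * (sg (s j).2 * colval j (s j).1 (v k)))
   <= L + c * \sum_i (expR ((2 * l) * rowsum i s) + expR ((- (2 * l)) * rowsum i s)).
  apply: fmax_le => k; rewrite add0r.
  have -> : \sum_j 2 * (sg (s j).2 * colval j (s j).1 (v k)) =
     \sum_i v k i * (2 * rowsum i s).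
    rewrite /colval /rowsum; under eq_bigr do rewrite !mulr_sumr.
    rewrite exchange_big /=; apply: eq_bigr => i _.
    by rewrite !mulr_sumr; apply: eq_bigr => j _; ring.
  apply: (@le_trans _ _ (\sum_i `|v k i| * (L + c * \sum_i (expR ((2 * l) * rowsum i s) + expR ((- (2 * l)) * rowsum i s))))).
    apply: ler_sum => i _; apply: le_trans (ler_norm _) _.
    rewrite normrM ler_wpM2l //.
    apply: le_trans (le_exp_excess L _ l0) _; rewrite lerD2l ler_wpM2l //.
    rewrite (bigD1 i) //= -[leLHS]addr0 lerD //; last first.
      by apply: sumr_ge0 => j _; rewrite addr_ge0 ?expR_ge0.
    by rewrite le_eqVlt; apply/orP; left; apply/eqP; congr (expR _ + expR _); ring.
  rewrite -mulr_suml -[leRHS]mul1r ler_wpM2r // addr_ge0 // mulr_ge0 //.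
  by apply: sumr_ge0 => j _; rewrite addr_ge0 ?expR_ge0.
apply: le_trans (Ex_le prob_weight_signed pw) _.
rewrite ExD (Ex_cst prob_weight_signed) lerD2l ExZ ler_wpM2l // Ex_sum.
apply: (@le_trans _ _ (\sum_(i < n) 2 * expR (4 * C1 * th * l ^+ 2 * p%:R))).
  apply: ler_sum => i _; rewrite ExD.
  have a1 : `|2 * l| <= 1 by rewrite ger0_norm; lra.
  have := Ex_expR_rowsum i a1.
  rewrite -normrN in a1; have := Ex_expR_rowsum i a1.
  rewrite sqrrN.
  have -> : C1 * th * (2 * l) ^+ 2 * p%:R = 4 * C1 * th * l ^+ 2 * p%:R by ring.
  lra.
by rewrite sumr_const card_ord -[_ *+ n]mulr_natr mulrAC.
Qed.

(** The sample space being finite, one vector per outcome, a witness of the event if there is one,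
    replaces the whole ball; symmetrisation then applies to this finite family. *)
Lemma Markov_one_sided (psi : R -> R) (tau l L : R) :
  (forall a b, psi a - psi b <= `|a - b|) -> psi 0 = 0 ->
  0 < l -> l <= 1 / 2 -> 0 <= L -> 0 <= tau ->
  tau * Ex colw (fun s => `[< exists v : 'I_n -> R, \sum_i `|v i| <= 1 /\
     tau <= \sum_j (psi (colval j (s j) v) -
                    \sum_e colw j e * psi (colval j e v)) >]%:R) <=
  L + expR (- (l * L)) / l * (2 * n%:R * expR (4 * C1 * th * l ^+ 2 * p%:R)).
Proof.
move=> psil psi0 l0 l2 L0 tau0.
pose dev (s : {ffun 'I_p -> {ffun 'I_n -> E}}) (v : 'I_n -> R) :=
  \sum_j (psi (colval j (s j) v) - \sum_e colw j e * psi (colval j e v)).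
have dev0 s : dev s (fun=> 0) = 0.
  have c0 j e : colval j e (fun=> 0) = 0.
    by rewrite /colval big1 // => i _; rewrite mul0r.
  rewrite /dev big1 // => j _; rewrite c0 psi0 big1 ?subrr // => e _.
  by rewrite c0 psi0 mulr0.
have /choice[f hf] : forall s, exists v : 'I_n -> R, \sum_i `|v i| <= 1 /\
    ((exists v, \sum_i `|v i| <= 1 /\ tau <= dev s v) -> tau <= dev s v).
  move=> s; case: (pselect (exists v, \sum_i `|v i| <= 1 /\ tau <= dev s v)).
    by move=> [v [v1 v2]]; exists v.
  by move=> h; exists (fun=> 0); split => //; rewrite big1 // => i _; rewrite normr0.
(* [None] adds the zero vector, whose deviation is 0; thus the maximum is nonnegative, as Markov's
   inequality requires. *)
pose F (k : option {ffun 'I_p -> {ffun 'I_n -> E}}) :=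
  if k is Some s then f s else (fun=> 0).
have F1 k : \sum_i `|F k i| <= 1.
  case: k => [s|] /=; first by case: (hf s).
  by rewrite big1 // => i _; rewrite normr0.
apply: le_trans (Ex_fmax_rowsum None F1 l0 l2 L0).
apply: le_trans (symmetrisation None psil (fun j e k => colval j e (F k)) (fun=> 0)
   prob_weight_colw).
rewrite -ExZ; apply: (Ex_le prob_weight_colw) => s.
have mx k : dev s (F k) <= fmax None (fun k => 0 + dev s (F k)).
  by apply: le_trans (fmax_ge _ _ k); rewrite add0r.
case: asboolP => h; rewrite ?mulr1 ?mulr0.
  by apply: le_trans (mx (Some s)); case: (hf s) => _; apply.
by apply: le_trans (mx None); rewrite /= dev0.
Qed.

(** By homogeneity v is rescaled to l1 norm 1; the two signs of the deviation are the one-sided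
    cases of the norm and of its negative, both 1-Lipschitz. Hence the leading factor 2. *)
Lemma finite_deviation (tau l L : R) :
  0 < l -> l <= 1 / 2 -> 0 <= L -> 0 < tau ->
  Ex colw (fun s => `[< exists v : 'I_n -> R, 0 < \sum_i `|v i| /\
     (\sum_i `|v i|) * tau <= `| \sum_j (`|colval j (s j) v| -
                    \sum_e colw j e * `|colval j e v|) | >]%:R) <=
  2 * (L + expR (- (l * L)) / l * (2 * n%:R * expR (4 * C1 * th * l ^+ 2 * p%:R)))
    / tau.
Proof.
move=> l0 l2 L0 tau0.
have h1 := @Markov_one_sided Num.norm tau l L (@lerB_dist _ _) (normr0 _)
  l0 l2 L0 (ltW tau0).
have lipN (a b : R) : - `|a| - - `|b| <= `|a - b|.
  by rewrite opprK addrC distrC; exact: lerB_dist.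
have N0 : - `|0 : R| = 0 by rewrite normr0 oppr0.
have h2 := @Markov_one_sided (fun a => - `|a|) tau l L lipN N0 l0 l2 L0 (ltW tau0).
rewrite ler_pdivlMr // mulrC.
apply: le_trans (le_trans (lerD h1 h2) _); last by rewrite [leRHS]mulr_natl mulr2n.
  rewrite -mulrDr -ExD ler_pM2l //; apply: (Ex_le prob_weight_colw) => s.
  case: asboolP => [[v [v0 hv]]|_]; last by rewrite addr_ge0 // ler0n.
  pose V := \sum_i `|v i|; pose v' i := V^-1 * v i.
  have v'1 : \sum_i `|v' i| <= 1.
    under eq_bigr do rewrite /v' normrM gtr0_norm ?invr_gt0 //.
    by rewrite -mulr_sumr mulVf // gt_eqF.
  have cv j e : `|colval j e v'| = V^-1 * `|colval j e v|.
    rewrite -{1}[V^-1]gtr0_norm ?invr_gt0 // -normrM /colval mulr_sumr.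
    by congr (`| _ |); apply: eq_bigr => i _; rewrite mulrA.
  have dv : \sum_j (`|colval j (s j) v'| - \sum_e colw j e * `|colval j e v'|) =
     V^-1 * \sum_j (`|colval j (s j) v| - \sum_e colw j e * `|colval j e v|).
    rewrite mulr_sumr; apply: eq_bigr => j _; rewrite cv mulrBr mulr_sumr.
    by congr (_ - _); apply: eq_bigr => e _; rewrite cv mulrCA.
  have {}hv : tau <= `| \sum_j (`|colval j (s j) v'| - \sum_e colw j e * `|colval j e v'|)|.
    by rewrite dv normrM gtr0_norm ?invr_gt0 // mulrC ler_pdivlMr // mulrC.
  case: (lerP 0 (\sum_j (`|colval j (s j) v'| - \sum_e colw j e * `|colval j e v'|))) => sgn.
    rewrite (ger0_norm sgn) in hv.
    have -> : `[< exists v : 'I_n -> R, \sum_i `|v i| <= 1 /\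
       tau <= \sum_j (`|colval j (s j) v| - \sum_e colw j e * `|colval j e v|) >] = true.
      by apply/asboolP; exists v'.
    by rewrite lerDl ler0n.
  rewrite (ltr0_norm sgn) -sumrN in hv.
  have -> : `[< exists v : 'I_n -> R, \sum_i `|v i| <= 1 /\
       tau <= \sum_j (- `|colval j (s j) v| - \sum_e colw j e * - `|colval j e v|) >] = true.
    apply/asboolP; exists v'; split => //; apply: (le_trans hv).
    rewrite le_eqVlt; apply/orP; left; apply/eqP; apply: eq_bigr => j _.
    by rewrite opprB -sumrN addrC; congr (_ + _); apply: eq_bigr => e _; rewrite mulrN opprK.
  by rewrite lerDr ler0n.
Qed.

End FiniteDeviation.

(** * Discretisation *)

Section BernoulliEntry.
Context {R : realType}.

(** From 1 - y <= exp(-y) one has (1 - y) exp(y) <= 1, while (1 - y)(1 + y + 2 y^2) = 1 + y^2 (1 - 2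
    y) >= 1. *)
Lemma expR_quad (y : R) : y <= 1 / 2 -> expR y <= 1 + y + 2 * y ^+ 2.
Proof.
move=> y2; have := expR_ge1Dx (- y); rewrite expRN.
have e0 := expR_gt0 y; set e := expR y in e0 *.
move=> h; have : (1 - y) * e <= 1.
  by have := ler_wpM2r (ltW e0) h; rewrite mulVf ?gt_eqF.
move=> h2.
have : (1 - y) * e <= (1 - y) * (1 + y + 2 * y ^+ 2).
  apply: le_trans h2 _.
  have -> : (1 - y) * (1 + y + 2 * y ^+ 2) = 1 + y ^+ 2 * (1 - 2 * y) by ring.
  by rewrite lerDl mulr_ge0 ?sqr_ge0 //; lra.
by rewrite ler_pM2l //; lra.
Qed.

Lemma expR_sym_quad (y : R) : expR y + expR (- y) <= 2 + y ^+ 2 * expR `|y|.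
Proof.
wlog y0 : y / 0 <= y.
  move=> H; case: (leP 0 y) => [/H//|/ltW h].
  by have := H (- y); rewrite oppr_ge0 opprK normrN sqrrN addrC; apply.
rewrite ger0_norm //.
have := expR_ge1Dx (- y); rewrite expRN.
have e0 := expR_gt0 y; set e := expR y in e0 *.
have i0 : 0 < e^-1 by rewrite invr_gt0.
have i1 : e^-1 <= 1 by rewrite invf_le1 // -(expR0 R) ler_expR.
move=> h; set f := e^-1 in i0 i1 h *.
have ef : e * f = 1 by rewrite mulfV ?gt_eqF.
(* e + f - 2 = e (1 - f)^2 *)
have -> : e + f = 2 + (1 - f) ^+ 2 * e.
  rewrite sqrrB expr1n mul1r mulrDl mulrBl mul1r expr2 -mulrA [f * e]mulrC ef mulr1.
  by rewrite mulrnAl [f * e]mulrC ef; ring.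
rewrite lerD2l ler_pM2r // lerXn2r ?nnegrE //; lra.
Qed.

Lemma sqr_le_expR (y : R) : y ^+ 2 <= 2 * expR `|y|.
Proof.
have := @expR_ge1Dxn R `|y| 1 (normr_ge0 _); rewrite real_normK ?num_real //.
by rewrite (_ : 2`!%:R = 2) //; lra.
Qed.

(** On chi = 0 both x and u vanish, so each exponential moment exceeds its trivial value only by a
    multiple of [th]. The correlation is th E[r (sg r - mu)] = th E|r|, because r has mean zero. *)
Lemma entry_law_bernoulli (S : finType) (q r : S -> R) (th C2 : R) :
  0 <= th -> th <= 1 -> prob_weight q -> \sum_a q a * r a = 0 ->
  1 / 20 <= \sum_a q a * `|r a| -> \sum_a q a * `|r a| <= 2 ->
  \sum_a q a * expR (2 * `|r a|) <= C2 ->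
  entry_law th C2 (1 / 20)
    (fun e : bool * S => (if e.1 then th else 1 - th) * q e.2)
    (fun e => if e.1 then r e.2 else 0)
    (fun e => if e.1 then Num.sg (r e.2) - \sum_a q a * Num.sg (r a) else 0).
Proof.
move=> th0 th1 [q0 q1] mean lo hi ex.
have split (F : bool * S -> R) : \sum_(e : bool * S) ((if e.1 then th else 1 - th) * q e.2) * F e =
    th * \sum_a q a * F (true, a) + (1 - th) * \sum_a q a * F (false, a).
  rewrite (eq_bigr (fun e : bool * S => (if e.1 then th else 1 - th) * q e.2 * F (e.1, e.2))); last by case.
  rewrite -(pair_bigA _ (fun (b : bool) a => (if b then th else 1 - th) * q a * F (b, a))) /=.
  rewrite big_bool /= !mulr_sumr.
  by congr (_ + _); apply: eq_bigr => a _; rewrite mulrA.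
have cst (a : R) : \sum_b q b * a = a by rewrite -mulr_suml q1 mul1r.
set mu := \sum_a q a * Num.sg (r a).
have mu1 : `|mu| <= 1.
  apply: le_trans (ler_norm_sum _ _ _) _; rewrite -q1; apply: ler_sum => a _.
  by rewrite normrM (ger0_norm (q0 a)) ler_piMr ?norm_sg_le1.
have u2 a : `|Num.sg (r a) - mu| <= 2.
  by apply: le_trans (ler_normB _ _) _; have := norm_sg_le1 (r a); lra.
split; [split | | | |split].
- by move=> [b a]; rewrite mulr_ge0 //=; case: b => //; lra.
- have := split (fun=> 1); rewrite !cst => h.
  transitivity (th * 1 + (1 - th) * 1); last by ring.
  by rewrite -h; apply: eq_bigr => e _; rewrite mulr1.
- by rewrite split /= mean cst !mulr0 addr0.
- by rewrite split /= normr0 cst mulr0 addr0 mulrC ler_wpM2r.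
- move=> m m1; rewrite split /= mulr0 oppr0 expR0 cst.
  have : \sum_a q a * (expR (m * r a) + expR (- (m * r a))) <= 2 + 2 * C2 * m ^+ 2.
    (* One factor exp|r| comes from [expR_sym_quad], the other absorbs r^2; hence the moment of 2|r|
       in the hypotheses. *)
    apply: (@le_trans _ _ (\sum_a q a * (2 + 2 * m ^+ 2 * expR (2 * `|r a|)))).
      apply: ler_sum => a _; apply: ler_wpM2l => //.
      apply: le_trans (expR_sym_quad _) _; rewrite lerD2l exprMn.
      rewrite [2 * m ^+ 2]mulrC -[leLHS]mulrA -[leRHS]mulrA ler_wpM2l ?sqr_ge0 //.
      have -> : 2 * `|r a| = `|r a| + `|r a| by ring.
      rewrite expRD mulrA.
      apply: ler_pM; rewrite ?sqr_ge0 ?expR_ge0 ?sqr_le_expR //.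
      by rewrite ler_expR normrM ler_piMl.
    under eq_bigr do rewrite mulrDr mulrCA.
    rewrite big_split /= cst -mulr_sumr lerD2l mulrAC ler_wpM2r //.
      by rewrite sqr_ge0.
    by rewrite ler_wpM2l.
  move/(ler_wpM2l th0); lra.
- by move=> [[] a] /=; rewrite ?normr0.
- move=> m m4; rewrite split /= mulr0 expR0 cst.
  have : \sum_a q a * expR (m * (Num.sg (r a) - mu)) <= 1 + 8 * m ^+ 2.
    (* The linear term averages to zero thanks to the centring by [mu]; 8 is 2 times the square of
       the bound 2 on |u|. *)
    apply: (@le_trans _ _ (\sum_a q a * (1 + m * (Num.sg (r a) - mu) + 8 * m ^+ 2))).
      apply: ler_sum => a _; apply: ler_wpM2l => //.
      have b : `|m * (Num.sg (r a) - mu)| <= 1 / 2.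
        by rewrite normrM; apply: le_trans (ler_pM _ _ m4 (u2 a)) _ => //; lra.
      apply: le_trans (expR_quad (le_trans (ler_norm _) b)) _.
      rewrite lerD2l exprMn mulrCA [8 * _]mulrC ler_wpM2l ?sqr_ge0 //.
      have : (Num.sg (r a) - mu) ^+ 2 <= 2 ^+ 2.
        by rewrite -real_normK ?num_real // lerXn2r ?nnegrE.
      lra.
    rewrite le_eqVlt; apply/orP; left; apply/eqP.
    transitivity (\sum_a q a * (1 - m * mu + 8 * m ^+ 2) + m * \sum_a q a * Num.sg (r a)).
      by rewrite [X in _ + X]mulr_sumr -big_split; apply: eq_bigr => a _ /=; ring.
    by rewrite cst -/mu; ring.
  move/(ler_wpM2l th0); lra.
- rewrite split /= mul0r cst mulr0 addr0 mulrC ler_wpM2l //.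
  apply: (le_trans lo).
  have -> : \sum_a q a * (r a * (Num.sg (r a) - mu)) =
    \sum_a q a * `|r a| - mu * \sum_a q a * r a.
    rewrite mulr_sumr -sumrB; apply: eq_bigr => a _; rewrite normrEsg; ring.
  by rewrite mean mulr0 subr0.
Qed.

(** Rounding down to the grid of mesh 1/M on the open interval from -M to M, which has 2 M^2
    half-open cells; [None] encodes the tail, sent to 0. *)
Lemma quantizer (M : nat) : (0 < M)%N ->
  exists (S : finType) (q : R -> S) (r : S -> R),
   [/\ forall a, measurable (q @^-1` [set a]),
       forall t, `|t| < M%:R -> `|r (q t) - t| <= M%:R^-1 &
       forall t, M%:R <= `|t| -> r (q t) = 0].
Proof.
move=> M0; have M0' : 0 < M%:R :> R by rewrite ltr0n.
pose N := (2 * M * M)%N.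
pose y (t : R) := (t + M%:R) * M%:R.
pose q (t : R) : option 'I_N :=
  if `|t| < M%:R then insub (Num.trunc (y t)) else None.
pose r (a : option 'I_N) : R := if a is Some k then (k : nat)%:R / M%:R - M%:R else 0.
have yI t : `|t| < M%:R -> 0 <= y t < N%:R.
  rewrite ltr_norml => /andP[t1 t2]; apply/andP; split.
    by rewrite mulr_ge0 ?ler0n //; lra.
  by rewrite /y /N natrM ltr_pM2r // natrM; lra.
have tI t : `|t| < M%:R -> (Num.trunc (y t) < N)%N.
  move=> /yI/andP[y1 y2]; rewrite -(ltr_nat R); apply: le_lt_trans y2.
  by case/andP: (truncn_itv y1).
have qS t : `|t| < M%:R -> exists2 k : 'I_N, q t = Some k & (k : nat) = Num.trunc (y t).
  by move=> t1; exists (Ordinal (tI _ t1)) => //; rewrite /q t1 insubT ?tI // => h; congr Some; apply: val_inj.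
exists (option 'I_N), q, r; split.
- case=> [k|].
    have -> : q @^-1` [set Some k] =
       `](- M%:R), M%:R[%classic `&` `[((k : nat)%:R / M%:R - M%:R), ((k : nat).+1%:R / M%:R - M%:R)[%classic.
      apply/seteqP; split => t /=.
        move=> qt; have t1 : `|t| < M%:R by move: qt; rewrite /q; case: ifP.
        have [k' qt' kE] := qS _ t1; move: qt; rewrite qt' => -[E]; subst k'.
        have /andP[y1 _] := yI _ t1; have /andP[] := truncn_itv y1.
        rewrite -kE !in_itv /= -ltr_norml t1 => h1 h2; split => //.
        by rewrite lerBlDr ltrBrDr ler_pdivrMr // ltr_pdivlMr // h1 h2.
      rewrite !in_itv /= -ltr_norml => -[t1].
      rewrite lerBlDr ltrBrDr ler_pdivrMr // ltr_pdivlMr // => h.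
      have [k' -> kE] := qS _ t1; congr Some; apply: val_inj; rewrite /= kE.
      by apply/eqP; rewrite truncn_eq //; case/andP: (yI _ t1).
    by apply: measurableI; exact: measurable_itv.
  have -> : q @^-1` [set None] = ~` `](- M%:R), M%:R[%classic.
    apply/seteqP; split => t /=; rewrite in_itv /= -ltr_norml.
      by move=> qt t1; have [k] := qS _ t1; rewrite qt.
    by move=> /negP/negPf h; rewrite /q h.
  by apply: measurableC; exact: measurable_itv.
- move=> t t1; have [k -> kE] := qS _ t1; rewrite /r kE.
  have /andP[y1 _] := yI _ t1; have /andP[h1 h2] := truncn_itv y1.
  set K := (Num.trunc (y t)) in h1 h2 *.
  have e1 : K%:R / M%:R - M%:R - t <= 0.
    have : K%:R / M%:R <= t + M%:R by rewrite ler_pdivrMr.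
    lra.
  rewrite ler0_norm // opprB lerBlDr.
  have : t + M%:R <= K.+1%:R / M%:R by rewrite ler_pdivlMr // ltW.
  rewrite -natr1 mulrDl mul1r; lra.
- by move=> t; rewrite leNgt => /negPf h; rewrite /q h.
Qed.

End BernoulliEntry.

(** * Integrals over the sample space and laws of finite-valued maps *)

Section RealIntegrals.
Context {d : measure_display} {T : measurableType d} {R : realType}.
Variable P : probability T R.
Implicit Types f g : T -> R.

Lemma ge0_le_integral_fin f g :
  measurable_fun setT f -> measurable_fun setT g -> (forall w, 0 <= f w) ->
  (forall w, f w <= g w) -> (\int[P]_w (f w)%:E <= \int[P]_w (g w)%:E)%E.
Proof.
move=> mf mg f0 fg; apply: ge0_le_integral => //.
- by move=> w _; rewrite lee_fin.
- exact/measurable_EFinP.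
- exact/measurable_EFinP.
- by move=> w _; rewrite lee_fin.
Qed.

Lemma ge0_integralD_fin f g :
  measurable_fun setT f -> measurable_fun setT g ->
  (forall w, 0 <= f w) -> (forall w, 0 <= g w) ->
  (\int[P]_w (f w + g w)%:E = \int[P]_w (f w)%:E + \int[P]_w (g w)%:E)%E.
Proof.
move=> mf mg f0 g0.
under eq_integral do rewrite EFinD.
apply: ge0_integralD => //.
- by move=> w _; rewrite lee_fin.
- exact/measurable_EFinP.
- by move=> w _; rewrite lee_fin.
- exact/measurable_EFinP.
Qed.

Lemma ge0_integralZl_fin f (a : R) :
  measurable_fun setT f -> (forall w, 0 <= f w) -> 0 <= a ->
  (\int[P]_w (a * f w)%:E = a%:E * \int[P]_w (f w)%:E)%E.
Proof.
move=> mf f0 a0.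
under eq_integral do rewrite EFinM.
apply: ge0_integralZl => //.
- exact/measurable_EFinP.
- by move=> w _; rewrite lee_fin.
Qed.

Lemma ge0_integral_sum_fin (J : finType) (f : J -> T -> R) :
  (forall j, measurable_fun setT (f j)) -> (forall j w, 0 <= f j w) ->
  (\int[P]_w (\sum_j f j w)%:E = \sum_j \int[P]_w (f j w)%:E)%E.
Proof.
move=> mf f0.
under eq_integral do rewrite -sumEFin.
apply: ge0_integral_sum => //.
- by move=> j; exact/measurable_EFinP.
- by move=> j w _; rewrite lee_fin.
Qed.

Lemma integral_cst_fin (a : R) : (\int[P]_w (a%:E) = a%:E)%E.
Proof.
have -> : (\int[P]_w (a%:E) = a%:E * P setT)%E by exact: integral_cst.
by rewrite probability_setT mule1.
Qed.

Section Code.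
Variables (S : finType) (code : T -> S).
Hypothesis mcode : forall s, measurable (code @^-1` [set s]).

Definition codew (s : S) : R := fine (P (code @^-1` [set s])).

Lemma code_indicE (F : S -> R) w :
  F (code w) = \sum_s F s * \1_(code @^-1` [set s]) w.
Proof.
rewrite (bigD1 (code w)) //= big1 ?addr0.
  by rewrite indicE mem_set // mulr1.
move=> s sw; rewrite indicE memNset ?mulr0 //= => E.
by move: sw; rewrite E eqxx.
Qed.

Lemma measurable_code (F : S -> R) : measurable_fun setT (fun w => F (code w)).
Proof.
under eq_fun do rewrite code_indicE.
by apply: measurable_sum => s; apply: measurable_funM => //; exact: measurable_indic.
Qed.

Let integrable_code1 (F : S -> R) s :
  P.-integrable setT (fun w => ((F s)%:E * (\1_(code @^-1` [set s]) w)%:E)%E).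
Proof. by apply: integrableZl => //; exact: integrable_indic. Qed.

Lemma integrable_code (F : S -> R) :
  P.-integrable setT (fun w => (F (code w))%:E).
Proof.
have -> : (fun w => (F (code w))%:E) =
   (fun w => (\sum_s ((F s)%:E * (\1_(code @^-1` [set s]) w)%:E)))%E.
  by apply/funext => w; rewrite code_indicE -sumEFin; apply: eq_bigr => s _; rewrite EFinM.
by apply: integrable_sum => // s _; exact: integrable_code1.
Qed.

Lemma codewE s : (codew s)%:E = P (code @^-1` [set s]).
Proof. by rewrite fineK // fin_num_measure. Qed.

Lemma integral_code (F : S -> R) :
  (\int[P]_w (F (code w))%:E = (\sum_s codew s * F s)%:E)%E.
Proof.
have -> : (fun w => (F (code w))%:E) =
   (fun w => (\sum_s ((F s)%:E * (\1_(code @^-1` [set s]) w)%:E)))%E.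
  by apply/funext => w; rewrite code_indicE -sumEFin; apply: eq_bigr => s _; rewrite EFinM.
rewrite integral_sum //.
rewrite -sumEFin; apply: eq_bigr => s _.
rewrite integralZl //; last exact: integrable_indic.
by rewrite integral_indic // setIT EFinM codewE muleC.
Qed.

Lemma prob_weight_codew : prob_weight codew.
Proof.
split=> [s|]; first by rewrite fine_ge0.
apply: EFin_inj; rewrite -(integral_cst_fin 1).
rewrite (integral_code (fun=> 1)).
by congr (_%:E); apply: eq_bigr => s _; rewrite mulr1.
Qed.

Lemma measurable_code_in (B : pred S) : measurable [set w | B (code w)].
Proof.
have := @measurable_code (fun s => (B s)%:R) measurableT [set 1%R] (measurable_set1 _).
rewrite setTI; congr measurable; apply/seteqP; split => w /=.
  by case: (B _) => // /eqP; rewrite eq_sym oner_eq0.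
by move=> ->.
Qed.

Lemma prob_code_in (B : pred S) :
  P [set w | B (code w)] = (\sum_s codew s * (B s)%:R)%:E.
Proof.
rewrite -(integral_code (fun s => (B s)%:R)).
have mB := measurable_code_in B.
transitivity (\int[P]_w (\1_[set w | B (code w)] w)%:E)%E; first by rewrite integral_indic // setIT.
apply: eq_integral => w _.
rewrite indicE; congr ((nat_of_bool _)%:R%:E); apply/idP/idP; first by rewrite inE.
by move=> h; rewrite inE.
Qed.

End Code.
End RealIntegrals.

(** * Rounding and recentring a single subgaussian variable *)

Section Quantised.
Context {d : measure_display} {T : measurableType d} {R : realType}.
Variables (P : probability T R) (X : T -> R) (M : nat).
Variables (S : finType) (q : R -> S) (r : S -> R).
Hypothesis M80 : (80 <= M)%N.
Hypothesis mq : forall a, measurable (q @^-1` [set a]).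
Hypothesis qr_close : forall t, `|t| < M%:R -> `|r (q t) - t| <= M%:R^-1.
Hypothesis qr_far : forall t, M%:R <= `|t| -> r (q t) = 0.
Hypothesis mX : measurable_fun setT X.
Hypothesis iX : P.-integrable setT (EFin \o X).
Hypothesis X_mean : (\int[P]_w (X w)%:E = 0)%E.
Hypothesis X_sq : (\int[P]_w ((X w) ^+ 2)%:E <= 1)%E.
Hypothesis X_abs : ((1 / 10)%:E <= \int[P]_w (`|X w|)%:E <= 1)%E.
Hypothesis X_tail : forall t : R, 0 < t ->
  (P [set w | (t <= `|X w|)%R ] <= (2 * expR (- (t ^+ 2) / 2))%:E)%E.

Definition qcode (w : T) : S := q (X w).
Definition qmean : R := \sum_a codew P qcode a * r a.
(** Rounding spoils the zero mean; the cross terms in the lower bound vanish only if it is restored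
    exactly. *)
Definition qval (a : S) : R := r a - qmean.

Let eta : R := 2 / M%:R.
Let M0 : 0 < M%:R :> R.
Proof. by rewrite ltr0n (leq_trans _ M80). Qed.

Let Mi0 : 0 <= M%:R^-1 :> R.
Proof. by rewrite invr_ge0 ltW. Qed.

Let eta40 : eta <= 1 / 40.
Proof.
have M80' : 80 <= M%:R :> R by rewrite ler_nat.
by rewrite /eta ler_pdivrMr //; lra.
Qed.

Lemma measurable_qcode a : measurable (qcode @^-1` [set a]).
Proof. by rewrite -[X in measurable X]setTI; exact: (mX measurableT (mq a)). Qed.
Let mc := measurable_qcode.

Lemma measurable_qerr : measurable_fun setT (fun w => `|r (qcode w) - X w|).
Proof.
apply: measurableT_comp => //; apply: measurable_funB => //.
exact: (measurable_code mc).
Qed.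

(** The error is at most 1/M on the grid, and in the tail it is |X| <= X^2 / M with E X^2 <= 1. The
    two contributions add up to [eta]. *)
Lemma integral_qerr : (\int[P]_w (`|r (qcode w) - X w|)%:E <= eta%:E)%E.
Proof.
have mX2 : measurable_fun setT (fun w => M%:R^-1 * X w ^+ 2).
  by apply: measurable_funM => //; apply: measurable_funX.
apply: (@le_trans _ _ (\int[P]_w (M%:R^-1 + M%:R^-1 * X w ^+ 2)%:E)%E).
  apply: ge0_le_integral_fin => //.
  - exact: measurable_qerr.
  - exact: measurable_funD.
  - move=> w; case: (ltP `|X w| M%:R) => h.
      by apply: le_trans (qr_close h) _; rewrite lerDl mulr_ge0 ?sqr_ge0.
    rewrite /qcode (qr_far h) sub0r normrN.
    apply: (@le_trans _ _ (M%:R^-1 * X w ^+ 2)); last by rewrite lerDr.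
    rewrite mulrC ler_pdivlMr // -[X w ^+ 2]real_normK ?num_real // expr2.
    by rewrite ler_wpM2l.
rewrite (ge0_integralD_fin P (measurable_cst _) mX2 (fun=> Mi0)); last first.
  by move=> w; rewrite mulr_ge0 ?sqr_ge0.
rewrite integral_cst_fin.
rewrite (ge0_integralZl_fin P (measurable_funX 2 mX) (fun w => sqr_ge0 _) Mi0).
apply: (@le_trans _ _ (M%:R^-1%:E + M%:R^-1%:E * 1)%E).
  by apply: leeD => //; apply: lee_wpmul2l => //; rewrite lee_fin.
by rewrite mule1 -EFinD lee_fin /eta; lra.
Qed.

Lemma qmean_le : `|qmean| <= eta.
Proof.
rewrite -lee_fin; apply: le_trans integral_qerr.
have -> : (`|qmean|%:E = `| \int[P]_w ((r (qcode w))%:E - (X w)%:E) |)%E.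
  rewrite integralB //; last exact: (integrable_code P mc).
  by rewrite X_mean (integral_code P mc) sube0.
apply: le_trans (le_abse_integral _ _ _) _ => //.
apply/measurable_EFinP; apply: measurable_funB => //.
exact: (measurable_code mc).
Qed.

Lemma integral_qval_err : (\int[P]_w (`|X w - qval (qcode w)|)%:E <= (2 * eta)%:E)%E.
Proof.
apply: (@le_trans _ _ (\int[P]_w (`|r (qcode w) - X w| + `|qmean|)%:E)%E).
  apply: ge0_le_integral_fin => //.
  - apply: measurableT_comp => //; apply: measurable_funB => //.
    exact: (measurable_code mc).
  - by apply: measurable_funD => //; exact: measurable_qerr.
  - move=> w; rewrite distrC (_ : qval _ - _ = (r (qcode w) - X w) - qmean).
      exact: ler_normB.
    by rewrite /qval; ring.
rewrite ge0_integralD_fin //; last exact: measurable_qerr.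
rewrite integral_cst_fin (_ : 2 * eta = eta + eta); last by ring.
by rewrite EFinD; apply: leeD; [exact: integral_qerr|rewrite lee_fin qmean_le].
Qed.

Lemma prob_weight_q : prob_weight (codew P qcode).
Proof. exact: prob_weight_codew. Qed.

Lemma qval_mean : \sum_a codew P qcode a * qval a = 0.
Proof.
rewrite /qval; under eq_bigr do rewrite mulrBr.
by rewrite sumrB -mulr_suml prob_weight_q.2 mul1r subrr.
Qed.

Let measurable_absX : measurable_fun setT (fun w => `|X w|).
Proof. exact: measurableT_comp. Qed.
Let measurable_err : measurable_fun setT (fun w => `|X w - qval (qcode w)|).
Proof.
apply: measurableT_comp => //; apply: measurable_funB => //.
exact: (measurable_code mc).
Qed.
Let measurable_val : measurable_fun setT (fun w => `|qval (qcode w)|).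
Proof. exact: (measurable_code mc (fun a => `|qval a|)). Qed.

(** The bound M >= 80 is chosen for this: it gives 1/10 - 2 eta >= 1/20. *)
Lemma qval_abs_ge : 1 / 20 <= \sum_a codew P qcode a * `|qval a|.
Proof.
have /andP[h _] := X_abs.
suff : ((1 / 10)%:E <= (\sum_a codew P qcode a * `|qval a| + 2 * eta)%:E)%E.
  by rewrite lee_fin; have := eta40; lra.
apply: (le_trans h); rewrite EFinD -(integral_code P mc (fun a => `|qval a|)).
apply: (@le_trans _ _ (\int[P]_w (`|qval (qcode w)| + `|X w - qval (qcode w)|)%:E)%E).
  apply: ge0_le_integral_fin => //; first exact: measurable_funD.
  by move=> w; rewrite -{1}[X w](subrK (qval (qcode w))) addrC; exact: ler_normD.
by rewrite ge0_integralD_fin // leeD // integral_qval_err.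
Qed.

Lemma qval_abs_le : \sum_a codew P qcode a * `|qval a| <= 2.
Proof.
have /andP[_ h] := X_abs.
rewrite -lee_fin -(integral_code P mc (fun a => `|qval a|)).
apply: (@le_trans _ _ (\int[P]_w (`|X w| + `|X w - qval (qcode w)|)%:E)%E).
  apply: ge0_le_integral_fin => //; first exact: measurable_funD.
  by move=> w; rewrite -{1}[qval _](subKr (X w)); exact: ler_normB.
rewrite ge0_integralD_fin //.
apply: le_trans (leeD h integral_qval_err) _.
by rewrite -EFinD lee_fin; have := eta40; lra.
Qed.

Let measurable_tail (k : nat) : measurable [set w | (k%:R <= `|X w|)%R].
Proof.
have := measurable_absX measurableT (measurable_itv `[(k%:R : R), +oo[).
rewrite setTI; congr measurable; apply/seteqP.
by split=> w /=; rewrite in_itv /= andbT.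
Qed.

(** Since (k - 3)^2 >= 0, the exponent 2k + 6 - k^2/2 is at most 11 - k, and exp(-k) <= 2^-k. The
    tail bound holds only for t > 0, so k = 0 uses P <= 1 instead. *)
Lemma tail_term (k : nat) :
  ((expR (2 * k%:R + 6))%:E * P [set w | (k%:R <= `|X w|)%R] <=
   (2 * expR 11 * 2^-1 ^+ k)%:E)%E.
Proof.
case: k => [|k].
  rewrite mulr0 add0r expr0 mulr1.
  apply: (@le_trans _ _ ((expR 6)%:E * 1)%E).
    apply: lee_wpmul2l; first by rewrite lee_fin expR_ge0.
    exact/probability_le1/(measurable_tail 0).
  rewrite mule1 lee_fin; apply: (@le_trans _ _ (expR 11)).
    by rewrite ler_expR; lra.
  by rewrite ler_peMl ?expR_ge0 //; lra.
have k0 : 0 < k.+1%:R :> R by rewrite ltr0n.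
set K := k.+1%:R in k0 *.
apply: (@le_trans _ _ ((expR (2 * K + 6))%:E * (2 * expR (- (K ^+ 2) / 2))%:E)%E).
  by apply: lee_wpmul2l; [rewrite lee_fin expR_ge0|exact: X_tail].
rewrite -EFinM lee_fin mulrCA -expRD -mulrA ler_pM2l //.
apply: (@le_trans _ _ (expR (11 - K))).
  rewrite ler_expR; have : 0 <= (K - 3) ^+ 2 by rewrite sqr_ge0.
  by rewrite sqrrB; lra.
rewrite expRD ler_pM2l ?expR_gt0 // /K -mulr_natr -mulNr expRM_natr.
rewrite lerXn2r ?nnegrE ?expR_ge0 ?invr_ge0 // expRN lef_pV2 ?posrE ?expR_gt0 //.
by have := expR_ge1Dx (1 : R); lra.
Qed.

Lemma geom_half_le (m : nat) : \sum_(k < m) 2^-1 ^+ k <= 2 :> R.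
Proof.
suff -> : \sum_(k < m) 2^-1 ^+ k = 2 - 2 * 2^-1 ^+ m :> R.
  by rewrite lerBlDr lerDl mulr_ge0 // exprn_ge0 // invr_ge0.
elim: m => [|m IH]; first by rewrite big_ord0 expr0; ring.
by rewrite big_ord_recr /= IH exprS; field.
Qed.

(** If k is the integer part of |X|, then |qval| <= (k + 1) + 1/M + |qmean| <= k + 3, whence the
    weight exp(2k + 6) on the event |X| >= k. For |X| >= M only |qmean| <= 1 remains, covered by the
    layer k = 0. *)
Lemma qval_exp : \sum_a codew P qcode a * expR (2 * `|qval a|) <= 4 * expR 11.
Proof.
rewrite -lee_fin -(integral_code P mc (fun a => expR (2 * `|qval a|))).
pose A k : set T := [set w | (k%:R <= `|X w|)%R].
have mA k : measurable (A k) by exact: measurable_tail.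
have mI (k : 'I_M.+1) : measurable_fun setT (fun w => expR (2 * (k : nat)%:R + 6) * \1_(A k) w : R).
  by apply: measurable_funM => //; exact: measurable_indic.
apply: (@le_trans _ _ (\int[P]_w (\sum_(k < M.+1) expR (2 * (k : nat)%:R + 6) * \1_(A k) w)%:E)%E).
  apply: ge0_le_integral_fin => //.
  - exact: (measurable_code mc (fun a => expR (2 * `|qval a|))).
  - exact: measurable_sum.
  - move=> w.
    have pick (k : 'I_M.+1) : A k w -> 2 * `|qval (qcode w)| <= 2 * (k : nat)%:R + 6 ->
      expR (2 * `|qval (qcode w)|) <= \sum_(k < M.+1) expR (2 * (k : nat)%:R + 6) * \1_(A k) w.
      move=> Akw le; rewrite (bigD1 k) //= indicE mem_set // mulr1.
      rewrite -[leLHS]addr0; apply: lerD; first by rewrite ler_expR.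
      by apply: sumr_ge0 => j _; rewrite mulr_ge0 ?expR_ge0.
    have mean1 : `|qmean| <= 1 by apply: le_trans qmean_le _; have := eta40; lra.
    case: (ltP `|X w| M%:R) => h.
      have /andP[t1 t2] := truncn_itv (normr_ge0 (X w)).
      have kM : (Num.trunc `|X w| < M.+1)%N.
        by rewrite -(ltr_nat R); apply: le_lt_trans t1 _; rewrite (lt_le_trans h) // ler_nat.
      apply: (pick (Ordinal kM)) => //=.
      have e1 := qr_close h.
      have M1 : M%:R^-1 <= 1 :> R by rewrite invf_le1 // ler1n (leq_trans _ M80).
      have n1 : `|qval (qcode w)| <= `|r (q (X w)) - X w| + `|X w| + `|qmean|.
        apply: le_trans (ler_normB _ _) _; rewrite lerD2r.
        by rewrite -{1}[r _](subrK (X w)); exact: ler_normD.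
      by rewrite -natr1 in t2; lra.
    apply: (pick ord0); first by rewrite /A /=.
    by rewrite /qval /qcode (qr_far h) sub0r normrN /=; lra.
rewrite ge0_integral_sum_fin //.
apply: (@le_trans _ _ (\sum_(k < M.+1) (2 * expR 11 * 2^-1 ^+ k)%:E)%E).
  apply: lee_sum => k _; rewrite ge0_integralZl_fin ?expR_ge0 //.
  by rewrite integral_indic // setIT; exact: tail_term.
rewrite sumEFin lee_fin -mulr_sumr.
apply: le_trans (ler_wpM2l _ (geom_half_le _)) _; first by rewrite mulr_ge0 ?expR_ge0.
by rewrite mulrAC; lra.
Qed.

End Quantised.

(** * Transfer to the discretised matrix *)

Section Transfer.
Context {d : measure_display} {T : measurableType d} {R : realType}.
Variable P : probability T R.

Lemma le_measure_bigsetU (I : Type) (s : seq I) (F : I -> set T) :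
  (forall i, measurable (F i)) ->
  (P (\big[setU/set0]_(i <- s) F i) <= \sum_(i <- s) P (F i))%E.
Proof.
move=> mF; elim: s => [|i s IH]; first by rewrite !big_nil measure0.
rewrite !big_cons; apply: le_trans (measureU2 _ _ _) _ => //.
  exact: bigsetU_measurable.
exact: leeD.
Qed.

Variables (n p : nat) (theta : R) (chi xi : 'I_n -> 'I_p -> T -> R).
Hypothesis th0 : 0 <= theta.
Hypothesis th1 : theta <= 1.
Hypothesis bs : bernoulli_subgaussian P theta chi xi.

Variables (M : nat) (S : finType) (q : R -> S) (r : S -> R).
Hypothesis M80 : (80 <= M)%N.
Hypothesis mq : forall a, measurable (q @^-1` [set a]).
Hypothesis qr_close : forall t, `|t| < M%:R -> `|r (q t) - t| <= M%:R^-1.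
Hypothesis qr_far : forall t, M%:R <= `|t| -> r (q t) = 0.

Let Ent : finType := (bool * S)%type.

(** Columns are the outer index: the matrix is a product over columns, each a product over entries,
    and [Ex] serves at both levels. *)
Definition mcode (w : T) : {ffun 'I_p -> {ffun 'I_n -> Ent}} :=
  [ffun j => [ffun i => (chi i j w == 1, q (xi i j w))]].

Definition entw (i : 'I_n) (j : 'I_p) (e : Ent) : R :=
  (if e.1 then theta else 1 - theta) * codew P (qcode (xi i j) q) e.2.

Definition entx (i : 'I_n) (j : 'I_p) (e : Ent) : R :=
  if e.1 then qval P (xi i j) q r e.2 else 0.

Definition entu (i : 'I_n) (j : 'I_p) (e : Ent) : R :=
  if e.1 then Num.sg (qval P (xi i j) q r e.2) -
    \sum_a codew P (qcode (xi i j) q) a * Num.sg (qval P (xi i j) q r a) else 0.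

Lemma measurable_chi i j : measurable_fun setT (chi i j).
Proof. by case: bs => -[m _] _ _ _ _; exact: (m (inl (i, j))). Qed.

Lemma measurable_xi i j : measurable_fun setT (xi i j).
Proof. by case: bs => -[m _] _ _ _ _; exact: (m (inr (i, j))). Qed.

Lemma entry_law_ent i j :
  entry_law theta (4 * expR 11) (1 / 20) (entw i j) (entx i j) (entu i j).
Proof.
have mX := measurable_xi i j.
case: bs => _ _ _ _ /(_ i j)[iX X0 X2 Xa Xt].
apply: entry_law_bernoulli => //.
- exact: prob_weight_q.
- exact: qval_mean.
- exact: (qval_abs_ge M80).
- exact: (qval_abs_le M80).
- exact: (qval_exp M80).
Qed.

Let fib (s : {ffun 'I_p -> {ffun 'I_n -> Ent}}) (k : ('I_n * 'I_p) + ('I_n * 'I_p)) : set R :=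
  match k with
  | inl ij => [set ((s ij.2 ij.1).1%:R : R)]
  | inr ij => q @^-1` [set (s ij.2 ij.1).2]
  end.

Let measurable_fib s k : measurable (fib s k).
Proof. by case: k => ij /=; [exact: measurable_set1|exact: mq]. Qed.

Let mcode_fib s : mcode @^-1` [set s] =
  \bigcap_(k in [set k | k \in finset.setTfor (('I_n * 'I_p) + ('I_n * 'I_p))%type]) (bs_family chi xi k @^-1` fib s k).
Proof.
have chi01 : forall i j w, chi i j w = 0 \/ chi i j w = 1 by case: bs.
apply/seteqP; split => w /=.
  move=> <- [[i j]|[i j]] _ /=; rewrite !ffunE //=.
  by case: (chi01 i j w) => ->; rewrite ?eqxx // eq_sym oner_eq0.
move=> h; apply/ffunP => j; apply/ffunP => i; rewrite !ffunE.
have /= h1 := h (inl (i, j)) (finset.in_setT _).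
have /= h2 := h (inr (i, j)) (finset.in_setT _).
rewrite h1 h2; case: (s j i) => -[] a /=; first by rewrite eqxx.
by rewrite eq_sym oner_eq0.
Qed.

Lemma measurable_mcode s : measurable (mcode @^-1` [set s]).
Proof.
rewrite mcode_fib; apply: fin_bigcap_measurable; first exact: finite_finset.
move=> k _; case: bs => -[m _] _ _ _ _.
by rewrite -[X in measurable X]setTI; exact: (m k measurableT).
Qed.

Lemma prob_chi i j (b : bool) :
  P (chi i j @^-1` [set (b%:R : R)]) = (if b then theta else 1 - theta)%:E.
Proof.
case: bs => _ chi01 chi1 _ _; case: b => /=; first exact: chi1.
have -> : chi i j @^-1` [set (0 : R)] = ~` (chi i j @^-1` [set (1 : R)]).
  apply/seteqP; split => w /=.
    by move=> -> /eqP; rewrite eq_sym oner_eq0.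
  by case: (chi01 i j w).
rewrite probability_setC ?chi1 //.
by rewrite -[X in measurable X]setTI; exact: (@measurable_chi i j measurableT).
Qed.

(** Independence of the chi's and xi's enters here: a fibre of [mcode] is an intersection of one
    event per variable, and the product formula is applied to the full index set. *)
Lemma codew_mcode s : codew P mcode s = \prod_j colw entw j (s j).
Proof.
apply: EFin_inj; rewrite (codewE P measurable_mcode) mcode_fib.
case: bs => -[_ ->] // _ _ _ _.
have -> : (\prod_(i in finset.setTfor (('I_n * 'I_p) + ('I_n * 'I_p))%type)
   P (bs_family chi xi i @^-1` fib s i) =
   \prod_(k : ('I_n * 'I_p) + ('I_n * 'I_p)) P (bs_family chi xi k @^-1` fib s k))%E.
  by apply: eq_bigl => k; rewrite finset.in_setT.
rewrite big_sumType /=.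
under eq_bigr do rewrite prob_chi.
under [X in (_ * X)%E]eq_bigr do rewrite -(codewE P (measurable_qcode mq (measurable_xi _ _))).
rewrite !prodEFin -EFinM -big_split /=; congr (_%:E).
rewrite /colw exchange_big pair_bigA /=.
by apply: eq_bigr => -[i j] _.
Qed.

Lemma sum_codew_mcode (F : {ffun 'I_p -> {ffun 'I_n -> Ent}} -> R) :
  \sum_s codew P mcode s * F s = Ex (colw entw) F.
Proof. by apply: eq_bigr => s _; rewrite codew_mcode. Qed.

Let err i j w : R := `|xi i j w - qval P (xi i j) q r (qcode (xi i j) q w)|.

Let err_ge0 i j w : 0 <= err i j w. Proof. exact: normr_ge0. Qed.

Let measurable_err i j : measurable_fun setT (err i j).
Proof.
apply: measurableT_comp => //; apply: measurable_funB; first exact: measurable_xi.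
exact: (measurable_code (measurable_qcode mq (measurable_xi i j))).
Qed.

Let Lt (s : {ffun 'I_p -> {ffun 'I_n -> Ent}}) (v : 'I_n -> R) : R :=
  \sum_j `|colval entx j (s j) v|.
Let L1 w (v : 'cV[R]_n) : R := l1norm ((rmat chi xi w)^T *m v).
Let V (v : 'cV[R]_n) : R := \sum_i `|v i 0|.
Let Et (v : 'cV[R]_n) : R :=
  \sum_j \sum_e colw entw j e * `|colval entx j e (fun i => v i 0)|.

Let L1_close w v : `|L1 w v - Lt (mcode w) (fun i => v i 0)| <=
  \sum_j \sum_i `|v i 0| * err i j w.
Proof.
rewrite /L1 /l1norm /Lt -sumrB; apply: le_trans (ler_norm_sum _ _ _) _.
apply: ler_sum => j _; apply: le_trans (ler_dist_dist _ _) _.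
rewrite mxE /colval -sumrB; apply: le_trans (ler_norm_sum _ _ _) _.
apply: ler_sum => i _; rewrite !mxE !ffunE /entx /err /qcode /=.
have [_ chi01 _ _ _] := bs.
rewrite mulrC -mulrBr normrM ler_wpM2l //.
case: (chi01 i j w) => ->; last by rewrite eqxx mul1r.
by rewrite eq_sym oner_eq0 mul0r subr0 normr0.
Qed.

Let measurable_L1 v : measurable_fun setT (fun w => L1 w v).
Proof.
rewrite /L1 /l1norm; apply: measurable_sum => j.
apply: measurableT_comp => //.
under eq_fun do rewrite mxE.
apply: measurable_sum => i; under eq_fun do rewrite !mxE.
apply: measurable_funM => //.
by apply: measurable_funM; [exact: measurable_chi|exact: measurable_xi].
Qed.

Let L1_ge0 w v : 0 <= L1 w v. Proof. exact: sumr_ge0. Qed.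
Let Lt_ge0 s v : 0 <= Lt s v. Proof. exact: sumr_ge0. Qed.

Let eta : R := 2 / M%:R.

Let toterr (v : 'cV[R]_n) w : R := \sum_j \sum_i `|v i 0| * err i j w.

Let toterr_ge0 (v : 'cV[R]_n) w : 0 <= toterr v w.
Proof. by apply: sumr_ge0 => j _; apply: sumr_ge0 => i _; rewrite mulr_ge0. Qed.

Let measurable_toterr (v : 'cV[R]_n) : measurable_fun setT (toterr v).
Proof. by apply: measurable_sum => j; apply: measurable_sum => i; apply: measurable_funM. Qed.

Let integral_toterr (v : 'cV[R]_n) :
  (\int[P]_w (toterr v w)%:E <= (p%:R * V v * (2 * eta))%:E)%E.
Proof.
have m1 i j : measurable_fun setT (fun w => `|v i 0| * err i j w).
  exact: measurable_funM.
have n1 i j w : 0 <= `|v i 0| * err i j w by rewrite mulr_ge0.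
rewrite (ge0_integral_sum_fin P (fun j => measurable_sum _ (fun i => m1 i j)))
  //; last by move=> j w; exact: sumr_ge0.
apply: (@le_trans _ _ (\sum_(j < p) (V v * (2 * eta))%:E)%E); last first.
  by rewrite sumEFin lee_fin sumr_const card_ord -[V v * (2 * eta) *+ p]mulr_natl mulrA.
apply: lee_sum => j _; rewrite ge0_integral_sum_fin //.
rewrite mulr_suml -sumEFin; apply: lee_sum => i _.
rewrite ge0_integralZl_fin // EFinM; apply: lee_wpmul2l; first by rewrite lee_fin.
case: bs => _ _ _ _ /(_ i j)[iX X0 X2 _ _].
by apply: (integral_qval_err M80) => //; exact: measurable_xi.
Qed.

Let integral_Lt (v : 'cV[R]_n) : (\int[P]_w (Lt (mcode w) (fun i => v i 0))%:E = (Et v)%:E)%E.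
Proof.
rewrite (integral_code P measurable_mcode (fun s => Lt s (fun i => v i 0))).
have pw j : prob_weight (colw entw j) by exact: (prob_weight_colw entry_law_ent).
rewrite sum_codew_mcode /Lt Ex_sum; congr (_%:E); apply: eq_bigr => j _.
exact: (Ex_single pw j (fun e => `|colval entx j e (fun i => v i 0)|)).
Qed.

Let measurable_Lt (v : 'cV[R]_n) : measurable_fun setT (fun w => Lt (mcode w) (fun i => v i 0)).
Proof. exact: (measurable_code measurable_mcode (fun s => Lt s (fun i => v i 0))). Qed.

(** A priori [mu_v] is an extended real; being sandwiched between [Et v] minus and plus the rounding
    error also shows that it is finite. *)
Let mu_close v : exists2 m : R, mu_v P chi xi v = m%:E &
  `|m - Et v| <= p%:R * V v * (2 * eta).
Proof.
have up : (mu_v P chi xi v <= (Et v + p%:R * V v * (2 * eta))%:E)%E.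
  rewrite EFinD -integral_Lt; apply: le_trans (leeD (lexx _) (integral_toterr v)).
  rewrite -ge0_integralD_fin //.
  apply: (ge0_le_integral_fin P (measurable_L1 v)
    (measurable_funD (measurable_Lt v) (measurable_toterr v))
    (fun w => L1_ge0 w v)) => w; rewrite -lerBlDl; apply: le_trans (ler_norm _) _.
  exact: L1_close.
have lo : ((Et v)%:E <= mu_v P chi xi v + (p%:R * V v * (2 * eta))%:E)%E.
  rewrite -integral_Lt; apply: le_trans (leeD (lexx _) (integral_toterr v)).
  rewrite -(ge0_integralD_fin P (measurable_L1 v) (measurable_toterr v)) //.
  apply: (ge0_le_integral_fin P (measurable_Lt v)
    (measurable_funD (measurable_L1 v) (measurable_toterr v))) => // w; rewrite -lerBlDl; apply: le_trans (ler_norm _) _.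
  by rewrite distrC; exact: L1_close.
move: up lo; case: (mu_v _ _ _ _) => [m| |] //=.
rewrite -EFinD !lee_fin => up lo; exists m => //.
by rewrite ler_norml; lra.
Qed.

Let V_gt0 v : v != 0 -> 0 < V v.
Proof.
move=> v0; rewrite lt_neqAle sumr_ge0 // andbT eq_sym.
apply: contra v0; rewrite psumr_eq0 // => /allP h.
apply/eqP/matrixP => i k; rewrite ord1 mxE; apply/eqP; rewrite -normr_eq0.
exact: h.
Qed.

Let err_le i j w : `|xi i j w| < M%:R -> err i j w <= 2 * eta.
Proof.
move=> h; case: bs => _ _ _ _ /(_ i j)[iX X0 X2 _ _].
have m_le := qmean_le M80 mq qr_close qr_far (measurable_xi i j) iX X0 X2.
rewrite /err /qval (_ : _ - (_ - _) = qmean P (xi i j) q r - (r (qcode (xi i j) q w) - xi i j w)); last by ring.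
apply: le_trans (ler_normB _ _) _; have := qr_close h.
have : 0 <= M%:R^-1 :> R by rewrite invr_ge0.
by rewrite /qcode /eta; lra.
Qed.

(** Here b is the lower bound for E|<x, v>| on the l1 sphere and tau the deviation threshold there.
    The primed parameters truncate phi, the others the row sums. In the factor c + 2, c pays for
    rounding inside c mu_v, and the 2 for rounding the norm and its mean. *)
Lemma bad_event_prob (c tau b l L l' L' : R) :
  0 < c -> 0 < tau -> 0 < l -> l <= 1 / 2 -> 0 <= L ->
  0 < l' -> l' <= 1 / 4 -> 0 < L' ->
  b * L' + 4 * theta * expR 1 * expR (8 * theta * l' ^+ 2 * n%:R) *
     (expR (- (l' * L')) / l') <= 1 / 20 * theta ->
  tau + (c + 2) * (2 * eta) * p%:R <= c * p%:R * b ->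
  outer_prob_le P (bad_event P chi xi c)
    (n%:R * p%:R * (2 * expR (- (M%:R ^+ 2) / 2)) +
     2 * (L + expR (- (l * L)) / l *
       (2 * n%:R * expR (4 * (4 * expR 11) * theta * l ^+ 2 * p%:R))) / tau).
Proof.
move=> c0 tau0 l0 l2 L0 l10 l14 L10 hb htau.
have low v : p%:R * b * V v <= Et v.
  rewrite (_ : p%:R * b * V v = \sum_(j < p) b * V v); last first.
    by rewrite sumr_const card_ord -[RHS]mulr_natl mulrA.
  apply: ler_sum => j _; rewrite -(ler_pM2l L10).
  have V0 : 0 <= V v by exact: sumr_ge0.
  have := l1norm_le_Ex (fun i => v i 0) th0 (fun i => entry_law_ent i j) l10 l14 (ltW L10).
  rewrite card_ord -/(V v); have := ler_wpM2l V0 hb.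
  set e' := 4 * theta * _ * _ * _; set E' := Ex _ _.
  rewrite (_ : \sum_e _ = E') //; lra.
pose B (s : {ffun 'I_p -> {ffun 'I_n -> Ent}}) :=
  `[< exists v : 'I_n -> R, 0 < \sum_i `|v i| /\
     (\sum_i `|v i|) * tau <= `| \sum_j (`|colval entx j (s j) v| -
                    \sum_e colw entw j e * `|colval entx j e v|) | >].
pose tail (ij : 'I_n * 'I_p) : set T := [set w | M%:R <= `|xi ij.1 ij.2 w|].
have mtail ij : measurable (tail ij).
  have mabs : measurable_fun setT (fun w => `|xi ij.1 ij.2 w|).
    by apply: measurableT_comp => //; exact: measurable_xi.
  have := mabs measurableT _ (measurable_itv `[(M%:R : R), +oo[).
  rewrite setTI; congr measurable; apply/seteqP.
  by split=> w /=; rewrite in_itv /= andbT.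
(* A measurable cover: either some |xi_ij| reaches M, or every rounding error is at most 2 eta and
   the discretised matrix deviates. *)
exists (\big[setU/set0]_ij tail ij `|` [set w | B (mcode w)]); split; last split.
- apply: measurableU; first exact: bigsetU_measurable.
  exact: (measurable_code_in measurable_mcode).
- move=> w [v [v0 hv]].
  case: (pselect (exists ij, tail ij w)) => [[ij h]|notail].
    by left; rewrite (bigD1 ij) //=; left.
  right; apply/asboolP; exists (fun i => v i 0); split; first exact: V_gt0.
  have [m mE m_close] := mu_close v.
  move: hv; rewrite mE -/(L1 w v) -EFinM -EFinB abse_EFin lee_fin => hv.
  rewrite sumrB -/(Lt (mcode w) (fun i => v i 0)) -/(Et v) -/(V v).
  have V0 := V_gt0 v0.
  have d1 : `|L1 w v - Lt (mcode w) (fun i => v i 0)| <= p%:R * V v * (2 * eta).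
    apply: le_trans (L1_close _ _) _.
    apply: (@le_trans _ _ (\sum_(j < p) V v * (2 * eta))); last first.
      by rewrite sumr_const card_ord -[V v * (2 * eta) *+ p]mulr_natl mulrA.
    apply: ler_sum => j _; rewrite mulr_suml; apply: ler_sum => i _.
    apply: ler_wpM2l => //; apply: err_le; rewrite ltNge; apply/negP => h.
    by apply: notail; exists (i, j).
  have := ler_wpM2l (ltW V0) htau.
  have := ler_wpM2l (ltW c0) (low v).
  have mge : Et v - p%:R * V v * (2 * eta) <= m.
    by move: m_close; rewrite ler_norml => /andP[]; lra.
  have := ler_wpM2l (ltW c0) mge.
  have : `|L1 w v - m| <= `|L1 w v - Lt (mcode w) (fun i => v i 0)| +
     (`|Lt (mcode w) (fun i => v i 0) - Et v| + `|m - Et v|).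
    rewrite [`|m - _|]distrC.
    apply: le_trans (ler_distD (Lt (mcode w) (fun i => v i 0)) _ _) _.
    by rewrite lerD2l; exact: ler_distD.
  move: (V v) (Lt _ _) d1 m_close hv => Vv Ltw; lra.
- apply: le_trans (measureU2 _ _ _) _.
  + exact: bigsetU_measurable.
  + exact: (measurable_code_in measurable_mcode).
  rewrite EFinD; apply: leeD.
    apply: le_trans (le_measure_bigsetU _ mtail) _.
    apply: (@le_trans _ _ (\sum_(ij : 'I_n * 'I_p) (2 * expR (- (M%:R ^+ 2) / 2))%:E)%E).
      apply: lee_sum => -[i j] _; case: bs => _ _ _ _ /(_ i j)[_ _ _ _]; apply.
      by rewrite ltr0n (leq_trans _ M80).
    rewrite sumEFin lee_fin sumr_const card_prod !card_ord.
    by rewrite -[_ * _ *+ (n * p)]mulr_natl natrM.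
  apply: (@le_trans _ _ (P [set w | B (mcode w)])) => //.
  rewrite (prob_code_in P measurable_mcode B) sum_codew_mcode lee_fin.
  exact: (finite_deviation entry_law_ent).
Qed.
End Transfer.

(** * Numerical estimates and choice of parameters *)

Section Numerics.
Context {R : realType}.

Lemma expRN_le_inv (x : R) : 0 < x -> expR (- x) <= x^-1.
Proof.
move=> x0; rewrite expRN lef_pV2 ?posrE ?expR_gt0 //.
by apply: le_trans (expR_ge1Dx _); rewrite lerDr.
Qed.

Lemma outer_prob_le_trans (d : measure_display) (T : measurableType d)
    (P : probability T R) (E : set T) (e1 e2 : R) :
  e1 <= e2 -> outer_prob_le P E e1 -> outer_prob_le P E e2.
Proof.
move=> e12 [A [mA [EA PA]]]; exists A; do 2!split => //.
by apply: le_trans PA _; rewrite lee_fin.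
Qed.

End Numerics.

Unset Implicit Arguments. Set Strict Implicit. Set Printing Implicit Defensive.

Theorem mainTheorem1 (R : realType) (c : R) :
  0 < c ->
  exists C : R, 0 < C /\
    forall eps : R, 0 < eps ->
    exists N : nat,
      forall (n p : nat) (theta : R),
        (N <= n)%N ->
        n%:R^-1 <= theta -> theta <= 1 ->
        C * n%:R * (ln (n%:R : R)) ^+ 4 <= p%:R ->
        forall (d : measure_display) (T : measurableType d) (P : probability T R)
               (chi xi : 'I_n -> 'I_p -> T -> R),
          bernoulli_subgaussian P theta chi xi ->
          outer_prob_le P (bad_event P chi xi c) eps.
Proof.
move=> c0; exists 1; split => // eps eps0.
pose H : R := 4 * expR 11.
have H0 : 0 < H by rewrite mulr_gt0 // expR_gt0.
(* 320 = 8 * 40 makes b L' = theta / 40, half of the margin theta / 20. The value stays hidden until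
   it is needed. *)
have [k k0 kE] : exists2 k : R, 0 < k & k = 320.
  by exists 320; rewrite ?ltr0n.
pose Q : R := 4 * k * (3 + 4 * H) / c.
have Q0 : 0 < Q by rewrite divr_gt0 // mulr_gt0 ?mulr_gt0 //; lra.
(* ln n >= Z will give Q^2 / ln n <= (eps / 2)^2, with Q the constant collected in the deviation
   bound. *)
pose Z : R := 2 + (2 * Q / eps) ^+ 2.
have Z2 : 2 <= Z by rewrite /Z lerDl sqr_ge0.
exists (Num.trunc (expR Z + 2 * k * expR 2)).+1 => n p theta nN th_lo th1 hp d T P chi xi bs.
have n_big : expR Z + 2 * k * expR 2 <= n%:R.
  apply: ltW; apply: lt_le_trans (truncnS_gt _) _.
  by rewrite ler_nat.
have eZ := expR_gt0 Z; have e2 := expR_gt0 (2 : R).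
have k2e : 0 < 2 * k * expR 2 by rewrite !mulr_gt0.
have n0 : 0 < n%:R :> R by lra.
set ell := ln (n%:R : R) in hp.
have expell : expR ell = n%:R by rewrite /ell lnK ?posrE.
have ellZ : Z <= ell by rewrite -ler_expR expell; lra.
have ell2 : 2 <= ell by lra.
have ell0 : 0 < ell by lra.
have th0 : 0 < theta by apply: lt_le_trans th_lo; rewrite invr_gt0.
have thn1 : 1 <= theta * n%:R by rewrite -ler_pdivrMr // div1r.
have ell4 : 0 < ell ^+ 4 by rewrite exprn_gt0.
have p_lo : n%:R * ell ^+ 4 <= p%:R by rewrite -[X in X * _]mul1r.
have p0 : 0 < p%:R :> R by apply: lt_le_trans p_lo; rewrite mulr_gt0.
have n1 : 1 <= n%:R :> R by have := expR_ge1Dx Z; lra.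
pose a : R := Num.sqrt (theta * n%:R).
have a2 : a ^+ 2 = theta * n%:R by rewrite sqr_sqrtr // ltW // mulr_gt0.
have a0 : 0 < a by rewrite sqrtr_gt0 mulr_gt0.
have a_n : a <= n%:R.
  rewrite -(@ler_pXn2r _ 2) ?nnegrE ?(ltW a0) ?(ltW n0) // a2 expr2 ler_pM2r //.
  exact: le_trans th1 n1.
have a1 : 1 <= a.
  by rewrite -(@ler_pXn2r _ 2) ?nnegrE ?(ltW a0) // a2 expr1n.
(* Chosen so that theta l^2 p = ln n: the exponential moment of a row sum is then a fixed power of
   n. *)
pose l : R := Num.sqrt (ell / (theta * p%:R)).
have thp0 : 0 < theta * p%:R by rewrite mulr_gt0.
have lsq : l ^+ 2 = ell / (theta * p%:R) by rewrite sqr_sqrtr // ltW // divr_gt0.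
have l0 : 0 < l by rewrite sqrtr_gt0 divr_gt0.
(* The hypothesis theta n >= 1 makes theta p large, which puts l in the admissible range. *)
have thp_lo : ell ^+ 4 <= theta * p%:R.
  apply: le_trans (ler_wpM2l (ltW th0) p_lo); rewrite mulrA.
  by rewrite ler_peMl // ltW.
have l_half : l <= 1 / 2.
  rewrite -(@ler_pXn2r _ 2) ?nnegrE ?(ltW l0) ?divr_ge0 // lsq ler_pdivrMr //.
  apply: (@le_trans _ _ ((1 / 2) ^+ 2 * ell ^+ 4)); last by rewrite ler_pM2l.
  have -> : (1 / 2) ^+ 2 * ell ^+ 4 = ell * (ell ^+ 3 / 4) by field.
  rewrite ler_peMr ?(ltW ell0) //.
  have : 2 ^+ 3 <= ell ^+ 3 by rewrite lerXn2r ?nnegrE ?(ltW ell0).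
  lra.
pose b : R := theta / (k * ell * a).
have b0 : 0 < b by rewrite divr_gt0 // !mulr_gt0.
pose tau : R := c * p%:R * b / 2.
have tau0 : 0 < tau.
  by apply: divr_gt0 => //; apply: mulr_gt0 => //; exact: mulr_gt0.
pose K : R := 8 * (c + 2) / (c * b) + 8 * (n%:R * p%:R) / eps.
pose M := (Num.trunc K + 80)%N.
have cb0 : 0 < c * b by exact: mulr_gt0.
have K1 : 0 <= 8 * (c + 2) / (c * b).
  by apply: divr_ge0; [lra|exact: ltW].
have K2 : 0 <= 8 * (n%:R * p%:R) / eps.
  by apply: divr_ge0; [rewrite !mulr_ge0|exact: ltW].
have MK : K <= M%:R.
  apply: ltW; apply: lt_le_trans (truncnS_gt _) _.
  by rewrite ler_nat /M -addn1 leq_add2l.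
have M80 : (80 <= M)%N by rewrite leq_addl.
have M0 : 0 < M%:R :> R by rewrite ltr0n (leq_trans _ M80).
have M1 : 1 <= M%:R :> R by rewrite ler1n (leq_trans _ M80).
have [S [q [r [mq qr_close qr_far]]]] := @quantizer R M (leq_trans (isT : 0 < 80)%N M80).
(* With this level exp(-l L) cancels the moment n^(4H) and leaves n^-2 against the n rows. *)
pose L : R := (2 + 4 * H) * ell / l.
have L0 : 0 <= L by rewrite ltW // divr_gt0 // mulr_gt0 //; lra.
(* This l' makes the exponent 8 theta l'^2 n equal to 1/2, and a >= 1 gives l' <= 1/4. The level L'
   then makes exp(-l' L') = n^-2; one factor 1/n absorbs a <= n, the other is small. *)
pose l' : R := (4 * a)^-1.
pose L' : R := 8 * ell * a.
have l'0 : 0 < l' by rewrite invr_gt0 mulr_gt0.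
have l'4 : l' <= 1 / 4.
  by rewrite /l' -[leRHS]invrK lef_pV2 ?posrE ?invr_gt0 ?mulr_gt0 // div1r invrK; lra.
have L'0 : 0 < L' by rewrite !mulr_gt0.
have hb : b * L' + 4 * theta * expR 1 * expR (8 * theta * l' ^+ 2 * n%:R) *
     (expR (- (l' * L')) / l') <= 1 / 20 * theta.
  have -> : b * L' = theta / 40 by rewrite /b /L' kE; field; rewrite !gt_eqF.
  have -> : 8 * theta * l' ^+ 2 * n%:R = 1 / 2.
    have -> : 8 * theta * l' ^+ 2 * n%:R = 8 * l' ^+ 2 * (theta * n%:R) by ring.
    by rewrite -a2 /l'; field; rewrite gt_eqF.
  have -> : l' * L' = ell + ell by rewrite /l' /L'; field; rewrite gt_eqF.
  rewrite opprD expRD !expRN expell.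
  have -> : n%:R^-1 * n%:R^-1 / l' = 4 * (a / n%:R) / n%:R.
    by rewrite /l'; field; rewrite !gt_eqF.
  have an : a / n%:R <= 1 by rewrite ler_pdivrMr ?mul1r.
  have ee : expR 1 * expR (1 / 2) <= expR 2 :> R by rewrite -expRD ler_expR; lra.
  have ee0 : 0 <= expR 1 * expR (1 / 2) :> R by rewrite mulr_ge0 ?expR_ge0.
  have an0 : 0 <= a / n%:R by rewrite divr_ge0 ?(ltW a0) ?(ltW n0).
  have h1 : expR 1 * expR (1 / 2) * (a / n%:R) <= expR 2.
    by rewrite -[leRHS]mulr1; apply: ler_pM.
  have h2 : expR 2 / n%:R <= 1 / (2 * k) :> R.
    by rewrite ler_pdivrMr // mulrAC ler_pdivlMr ?mulr_gt0 // mul1r mulrC; lra.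
  have h3 : expR 1 * expR (1 / 2) * (a / n%:R) / n%:R <= 1 / (2 * k).
    by apply: le_trans h2; rewrite ler_pM2r ?invr_gt0.
  have := ler_wpM2l (ltW th0) h3.
  have -> : 4 * theta * expR 1 * expR (1 / 2) * (4 * (a / n%:R) / n%:R) =
    16 * (theta * (expR 1 * expR (1 / 2) * (a / n%:R) / n%:R)) by ring.
  by rewrite kE; lra.
have htau : tau + (c + 2) * (2 * (2 / M%:R)) * p%:R <= c * p%:R * b.
  have : 8 * (c + 2) / (c * b) <= M%:R by rewrite /K in MK; lra.
  rewrite ler_pdivrMr // => h.
  suff : (c + 2) * (2 * (2 / M%:R)) <= c * b / 2.
    by move/(ler_wpM2r (ltW p0)); rewrite /tau; lra.
  have -> : (c + 2) * (2 * (2 / M%:R)) = 4 * (c + 2) / M%:R by field; rewrite gt_eqF.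
  by rewrite ler_pdivrMr //; lra.
apply: outer_prob_le_trans (bad_event_prob (ltW th0) th1 bs M80 mq qr_close qr_far
   c0 tau0 l0 l_half L0 l'0 l'4 L'0 hb htau).
have first_le : n%:R * p%:R * (2 * expR (- (M%:R ^+ 2) / 2)) <= eps / 2.
  have h1 : expR (- (M%:R ^+ 2) / 2) <= 2 / M%:R :> R.
    have M22 : 0 < M%:R ^+ 2 / 2 :> R by rewrite divr_gt0 ?exprn_gt0.
    rewrite mulNr; apply: le_trans (expRN_le_inv M22) _.
    rewrite invf_div ler_pM2l // lef_pV2 ?posrE ?exprn_gt0 //.
    by rewrite expr2 ler_peMl // ltW.
  have h2 : 8 * (n%:R * p%:R) / eps <= M%:R by rewrite /K in MK; lra.
  rewrite ler_pdivrMr // in h2.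
  have np0 : 0 <= n%:R * p%:R * 2 :> R by rewrite !mulr_ge0 // ltW.
  have := ler_wpM2l np0 h1; rewrite -[_ * 2 * expR _]mulrA => h3.
  apply: le_trans h3 _.
  have -> : n%:R * p%:R * 2 * (2 / M%:R) = 4 * (n%:R * p%:R) / M%:R :> R.
    by field; rewrite gt_eqF.
  by rewrite ler_pdivrMr //; lra.
have second_le : 2 * (L + expR (- (l * L)) / l *
       (2 * n%:R * expR (4 * (4 * expR 11) * theta * l ^+ 2 * p%:R))) / tau <= eps / 2.
  have thlp : theta * l ^+ 2 * p%:R = ell by rewrite lsq; field; rewrite !gt_eqF.
  have -> : 4 * (4 * expR 11) * theta * l ^+ 2 * p%:R = 4 * H * ell.
    by rewrite -thlp /H; ring.
  have lL : l * L = ell + ell + 4 * H * ell by rewrite /L; field; rewrite gt_eqF.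
  have t1 : expR (- (l * L)) / l * (2 * n%:R * expR (4 * H * ell)) <= ell / l.
    rewrite lL !opprD !expRD !expRN expell.
    have -> : n%:R^-1 * n%:R^-1 * (expR (4 * H * ell))^-1 / l *
       (2 * n%:R * expR (4 * H * ell)) = 2 / n%:R / l.
      by field; rewrite !gt_eqF // expR_gt0.
    rewrite ler_pM2r ?invr_gt0 //; apply: le_trans ell2.
    by rewrite ler_pdivrMr // ler_peMr.
  have t2 : L + expR (- (l * L)) / l * (2 * n%:R * expR (4 * H * ell)) <=
     (3 + 4 * H) * (ell / l) by rewrite /L; lra.
  pose y : R := ell ^+ 2 * a / (l * p%:R * theta).
  have y0 : 0 <= y by rewrite ltW // divr_gt0 // !mulr_gt0 // exprn_gt0.
  apply: (@le_trans _ _ (Q * y)).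
    rewrite ler_pdivrMr //; apply: (le_trans (ler_wpM2l _ t2)) => //.
    rewrite le_eqVlt; apply/orP; left; apply/eqP.
    by rewrite /Q /y /tau /b; field; rewrite !gt_eqF.
  have ysq : y ^+ 2 <= ell^-1.
    (* theta cancels, so p >= n (ln n)^4 bounds y^2 by 1 / ln n uniformly in theta. *)
    have -> : y ^+ 2 = ell ^+ 3 * n%:R / p%:R.
      rewrite /y exprMn exprVn !exprMn lsq a2.
      by field; rewrite !gt_eqF.
    rewrite ler_pdivrMr //.
    have -> : ell ^+ 3 * n%:R = ell^-1 * (n%:R * ell ^+ 4) by field; rewrite gt_eqF.
    by rewrite ler_pM2l ?invr_gt0.
  have Qy0 : 0 <= Q * y by apply: mulr_ge0 => //; exact: ltW.
  have heps : 0 <= eps / 2 by lra.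
  rewrite -(@ler_pXn2r _ 2) ?nnegrE //.
  rewrite exprMn; apply: (@le_trans _ _ (Q ^+ 2 / ell)).
    by rewrite ler_wpM2l ?sqr_ge0.
  rewrite ler_pdivrMr //.
  have : (2 * Q / eps) ^+ 2 <= ell by rewrite /Z in ellZ; lra.
  have -> : (2 * Q / eps) ^+ 2 = Q ^+ 2 / (eps / 2) ^+ 2 by field; rewrite gt_eqF.
  by rewrite ler_pdivrMr ?exprn_gt0 ?divr_gt0 // mulrC.
by apply: le_trans (lerD first_le second_le) _; rewrite -splitr.
Qed.
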